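(* Let $r$ be the target rank, with $r \le m$ and $\lambda_{r+1} \neq 0$, let $p \ge 2$ be an oversampling parameter, and let $\ell = r+p$. Let $\Omega \in \mathbb{R}^{n\times \ell}$ be a standard Gaussian random matrix, used as the random matrix in the Nyström algorithm described in the context, applied to $H = A^\top A$ with sketch parameter $\ell$. Let $\widehat{H} = \widehat{V}\widehat{\Lambda}\widehat{V}^\top$ be the output of that algorithm, and define $\widehat{\mathcal{H}} = \Gamma^{-1/2}(I+\widehat{H})\Gamma^{-1/2}$. Let $$\Psi_{H}(r,p) = \lambda_{r+1} + \frac{r}{p-1}\sum_{j>r}\lambda_j = \left(1 + \frac{r}{p-1}\,\mathrm{id}_r\right)\lambda_{r+1}, \qquad \mathrm{id}_r = \frac{\sum_{j>r}\lambda_j}{\lambda_{r+1}}.$$ Then the following bounds hold. 1. The error in the SketchSolv solution $\delta\widehat{x}$ satisfies $$\mathbb{E}\left[\frac{\|\delta x - \delta\widehat{x}\|_{\Gamma^{-1}}}{\|\delta x\|_{\Gamma^{-1}}}\right] \le \Psi_{H}(r,p).$$ 2. The condition number of the operator preconditioned by the SketchPrec method (that is, with preconditioner $(I+\widehat{H})^{-1}$) satisfies $$\mathbb{E}\left[\kappa_2\left((I+\widehat{H})^{-1/2}(I+H)(I+\widehat{H})^{-1/2}\right)\right] \le 1 + \Psi_{H}(r,p).$$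
   Context: Setting: $m \le n$; $A \in \mathbb{R}^{m\times n}$ is a given matrix with singular values $\sigma_1 \ge \dots \ge \sigma_m \ge 0$; $H = A^\top A \in \mathbb{R}^{n\times n}$ has eigenvalues $\lambda_j = \sigma_j^2$ for $1\le j\le m$ and $\lambda_j = 0$ for $m<j\le n$. (In the data assimilation application, $A$ is obtained by stacking the blocks $R_i^{-1/2} O_i M_i \Gamma^{1/2}$, $i=1,\dots,n_t$, where $M_i$ and $O_i$ are the linearized model and observation operators and $R_i$ the observation error covariances, at a single Gauss-Newton iterate.) $\Gamma \in \mathbb{R}^{n\times n}$ is the symmetric positive definite prior covariance and $g\in\mathbb{R}^n$ is the gradient of the cost function at the current iterate (the relative error in part 1 is understood for $g \neq 0$). Gauss-Newton Hessian: $\mathcal{H} = \Gamma^{-1/2}(I+H)\Gamma^{-1/2}$. The exact step $\delta x$ solves $\mathcal{H}\,\delta x = -g$. The SketchSolv solution $\delta\widehat{x}$ solves $\widehat{\mathcal{H}}\,\delta\widehat{x} = -g$, i.e. $\delta\widehat{x} = -\Gamma^{1/2}(I+\widehat{H})^{-1}\Gamma^{1/2} g$ (with the inverse applied through the Woodbury formula $(I+\widehat{H})^{-1} = I - \widehat{V}(\widehat{\Lambda}^{-1}+I)^{-1}\widehat{V}^\top$). Nyström algorithm (input: operator $H = A^\top A$, sketch parameter $\ell$): (1) draw a Gaussian random matrix $\Omega \in \mathbb{R}^{n\times\ell}$; (2) compute $Y = H\Omega$; (3) compute $\nu = \sqrt{n}\,\epsilon_{\rm mach}\|Y\|_2$,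 where $\epsilon_{\rm mach}$ is machine epsilon; (4) replace $Y$ by $Y + \nu\Omega$; (5) compute the lower Cholesky triangular factor $L$ of $(C + C^\top)/2$, where $C = \Omega^\top Y$; (6) compute $W = L^{-1}Y^\top$; (7) compute the thin SVD, truncated to rank $r$, of $W$, written $\widehat{U}\widehat{\Sigma}\widehat{V}^\top$; (8) return $\widehat{V}$ and $\widehat{\Lambda} = \max\{0, \widehat{\Sigma}^2 - \nu I\}$, which define the approximation $\widehat{H} = \widehat{V}\widehat{\Lambda}\widehat{V}^\top$ of $H$. (The algorithm is presented as a numerically stable implementation of the Nyström approximation $H\Omega(\Omega^\top H\Omega)^\dagger(H\Omega)^\top$, with $^\dagger$ the Moore-Penrose inverse.) Notation: $\|x\|_{M} = \|M^{1/2}x\|_2$ for symmetric positive definite $M$; $\kappa_2(M) = \|M\|_2\|M^{-1}\|_2$ for invertible $M$, with $\|\cdot\|_2$ the spectral norm for matrices. A standard Gaussian random matrix has independent entries with zero mean and unit variance Gaussian distribution. The expectation is over $\Omega$.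
   Formalization: The Nyström algorithm is taken with machine epsilon 0, so ν = 0 (for fixed ε_mach > 0 the bounds fail, e.g. H = diag(1,t,t,t), r = 1, p = 2, Γ = I, t → 0), and L^{-1} is read as the Moore–Penrose inverse when the Cholesky factor L is singular. *)

(* Defs.v *)
From HB Require Import structures.
From mathcomp Require Import all_boot all_order all_algebra.
From mathcomp Require Import all_classical all_reals all_analysis.

Set Implicit Arguments.
Unset Strict Implicit.
Unset Printing Implicit Defensive.

Import Order.TTheory GRing.Theory Num.Theory.

Local Open Scope classical_set_scope.
Local Open Scope ring_scope.

Definition norm2 (R : realType) (n : nat) (x : 'cV[R]_n) : R :=
  Num.sqrt (\sum_i x i 0 ^+ 2).

Definition specnorm (R : realType) (m n : nat) (M : 'M[R]_(m, n)) : R :=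
  sup [set norm2 (M *m x) | x in [set x : 'cV[R]_n | norm2 x <= 1]].

(* Meaningful for invertible [M] only: [invmx M] is [M] otherwise. *)
Definition cond2 (R : realType) (n : nat) (M : 'M[R]_n) : R :=
  specnorm M * specnorm (invmx M).

Definition psdmx (R : realType) (n : nat) (M : 'M[R]_n) : Prop :=
  M^T = M /\ forall x : 'cV[R]_n, 0 <= (x^T *m M *m x) 0 0.

Definition spdmx (R : realType) (n : nat) (M : 'M[R]_n) : Prop :=
  M^T = M /\ forall x : 'cV[R]_n, x != 0 -> 0 < (x^T *m M *m x) 0 0.

(* The principal square root: a positive semidefinite [M] has exactly one
   positive semidefinite square root, which [xget] selects. *)
Definition sqrtmx (R : realType) (n : nat) (M : 'M[R]_n) : 'M[R]_n :=
  xget 0 [set S : 'M[R]_n | psdmx S /\ S *m S = M].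

Definition wnorm (R : realType) (n : nat) (M : 'M[R]_n) (x : 'cV[R]_n) : R :=
  norm2 (sqrtmx M *m x).

Definition is_thin_svd (R : realType) (a b k : nat) (W : 'M[R]_(a, b))
    (U : 'M[R]_(a, k)) (s : 'rV[R]_k) (V : 'M[R]_(b, k)) : Prop :=
  [/\ k = minn a b,
      U^T *m U = 1%:M, V^T *m V = 1%:M,
      (forall i, 0 <= s 0 i) /\ (forall i j : 'I_k, (i <= j)%N -> s 0 j <= s 0 i)
    & W = U *m diag_mx s *m V^T].

Definition is_trunc_svd (R : realType) (a b r : nat) (W : 'M[R]_(a, b))
    (U : 'M[R]_(a, r)) (s : 'rV[R]_r) (V : 'M[R]_(b, r)) : Prop :=
  exists (q : nat) (U' : 'M[R]_(a, q)) (s' : 'rV[R]_q) (V' : 'M[R]_(b, q)),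
    is_thin_svd W (row_mx U U') (row_mx s s') (row_mx V V').

Definition is_singular_values (R : realType) (m n : nat) (A : 'M[R]_(m, n))
    (sigma : 'rV[R]_m) : Prop :=
  exists (U : 'M[R]_m) (V : 'M[R]_(n, m)), is_thin_svd A U sigma V.

(* Counted from 0, so that [lam sigma j] is lambda_{j+1}; the value is 0 from
   index [m] on. *)
Definition lam (R : realType) (m : nat) (sigma : 'rV[R]_m) (j : nat) : R :=
  oapp (fun i : 'I_m => sigma 0 i ^+ 2) 0 (insub j).

Definition intdim (R : realType) (m n : nat) (sigma : 'rV[R]_m) (r : nat) : R :=
  (\sum_(r <= j < n) lam sigma j) / lam sigma r.

Definition Psi (R : realType) (m n : nat) (sigma : 'rV[R]_m) (r p : nat) : R :=
  lam sigma r + r%:R / (p%:R - 1) * \sum_(r <= j < n) lam sigma j.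

(* The four Penrose equations. *)
Definition is_pinv (R : realType) (m n : nat) (M : 'M[R]_(m, n))
    (N : 'M[R]_(n, m)) : Prop :=
  [/\ M *m N *m M = M, N *m M *m N = N,
      (M *m N)^T = M *m N & (N *m M)^T = N *m M].

(* Nonnegative rather than positive diagonal entries, so that a singular
   positive semidefinite [C] has a factor too. *)
Definition is_cholesky (R : realType) (l : nat) (C L : 'M[R]_l) : Prop :=
  [/\ is_trig_mx L, (forall i, 0 <= L i i) & L *m L^T = C].

(* [V] and [Lam] are an output of the Nystrom algorithm on [H] and [Omega] with
   machine epsilon [eps] and truncation rank [r]; exact arithmetic is [eps = 0],
   where the stabilising shift [nu] vanishes. The inverse of the Cholesky
   factor is read as its Moore-Penrose inverse [Li], which is [invmx L] when
   [L] is invertible. As C^+ = (L L^T)^+ = Li^T Li, for [eps = 0] one then has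
   W^T W = H Omega (Omega^T H Omega)^+ (H Omega)^T also when Omega^T H Omega
   is singular. Neither [L] nor the truncated SVD need be unique, whence a
   relation. *)
Definition nystrom_output (R : realType) (eps : R) (n l r : nat)
    (H : 'M[R]_n) (Omega : 'M[R]_(n, l))
    (V : 'M[R]_(n, r)) (Lam : 'M[R]_r) : Prop :=
  let nu := Num.sqrt n%:R * eps * specnorm (H *m Omega) in
  let Y := H *m Omega + nu *: Omega in
  let C := Omega^T *m Y in
  exists (L Li : 'M[R]_l) (U : 'M[R]_(l, r)) (s : 'rV[R]_r),
    [/\ is_cholesky (2^-1 *: (C + C^T)) L,
        is_pinv L Li,
        is_trunc_svd (Li *m Y^T) U s V
      & Lam = diag_mx (\row_j Num.max 0 (s 0 j ^+ 2 - nu))].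

Definition nystrom_approx (R : realType) (n r : nat)
    (V : 'M[R]_(n, r)) (Lam : 'M[R]_r) : 'M[R]_n :=
  V *m Lam *m V^T.

Definition gn_hessian (R : realType) (n : nat) (Gam H : 'M[R]_n) : 'M[R]_n :=
  invmx (sqrtmx Gam) *m (1%:M + H) *m invmx (sqrtmx Gam).

Definition prec_operator (R : realType) (n : nat) (H Hhat : 'M[R]_n) : 'M[R]_n :=
  invmx (sqrtmx (1%:M + Hhat)) *m (1%:M + H) *m invmx (sqrtmx (1%:M + Hhat)).

Definition mutually_independent (d : measure_display) (T : measurableType d)
    (R : realType) (P : probability T R) (I : finType) (X : I -> {RV P >-> R})
    : Prop :=
  forall (J : {set I}) (B : I -> set R), (forall i, measurable (B i)) ->
    P (\bigcap_(i in [set` J]) (X i @^-1` B i)) =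
    (\prod_(i in J) P (X i @^-1` B i))%E.

Definition standard_gaussian (d : measure_display) (T : measurableType d)
    (R : realType) (P : probability T R) (n l : nat)
    (Omega : 'I_n * 'I_l -> {RV P >-> R}) : Prop :=
  mutually_independent Omega /\
  forall ij (B : set R), measurable B ->
    distribution P (Omega ij) B = normal_prob 0 1 B.

Definition sample_mx (d : measure_display) (T : measurableType d)
    (R : realType) (P : probability T R) (n l : nat)
    (Omega : 'I_n * 'I_l -> {RV P >-> R}) (w : T) : 'M[R]_(n, l) :=
  \matrix_(i, j) Omega (i, j) w.

(* Main.v *)
Require Import Defs.
From HB Require Import structures.
From mathcomp Require Import all_boot all_order all_algebra.
From mathcomp Require Import all_classical all_reals all_analysis.
From mathcomp Require Import measurable_realfun ring lra.

(* Write P for the orthogonal projector onto the range of A Omega, so that the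
   exact Nystrom approximation is N = A^T P A, and Hhat is its best rank r part.
   With V1 the leading right singular vectors of A, Ky Fan's inequality bounds
   tr (H - Hhat) by sum_(j > r) lambda_j + |A V1 - A Omega M|_F^2 for every M,
   since P fixes A Omega M.  As H - Hhat is positive semidefinite, applying Ky
   Fan once more to a projector of rank r + 1 that contains the range of Hhat and
   a given vector removes the tail: |H - Hhat| is at most
   lambda_(r+1) + |A V1 - A Omega M|_F^2.
   Both assertions then follow from E |H - Hhat| <= Psi, by
   (I + Hhat) (y - yhat) = - (H - Hhat) y and I + Hhat <= I + H.
   For M take the ridge pseudo-inverse Z^T K of Z = V1^T Omega, where
   K = (Z Z^T + eps I)^-1; bounded K keeps every integral finite.  The
   expectations come from Gaussian integration by parts,
   E (div F - <Omega, F>) = 0: the field V1 K Z gives (p - 1) E tr K <= r, and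
   v v^T Omega S with S = Z^T K K Z gives E (v^T Omega S Omega^T v) <= E tr K
   for a unit vector v orthogonal to V1.  Finally eps tends to 0. *)

Set Implicit Arguments.
Unset Strict Implicit.
Unset Printing Implicit Defensive.

Import Order.TTheory GRing.Theory Num.Theory.
Import numFieldNormedType.Exports.

Local Open Scope classical_set_scope.
Local Open Scope ring_scope.

(** * Integration by parts against the Gaussian law on the line *)

Section gaussian_integral.
Context {R : realType}.
Local Notation mu := (@lebesgue_measure R).
Local Notation gauss := (@normal_prob R 0 1).
Local Notation pdf := (@normal_pdf R 0 1).

(** Integration by parts stands in for two facts on Gaussian matrices: the independence of V1^T
    Omega from the part of Omega orthogonal to V1, and the mean of an inverse Wishart matrix. For
    the first, orthogonality of v and V1 kills every term of the divergence that contains the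
    derivative of S. For the second, the divergence contains (l - tr Q) tr K, where Q = Z^T K Z has
    trace at most r. The ridge parameter makes both fields rational without poles and of at most
    linear growth, even where Z loses rank, so that each estimate holds at every sample point. The
    algorithm is a relation, and an output selected at each sample point may depend on it in a
    non-measurable way. The error is therefore dominated pointwise by a rational, hence measurable,
    function of Omega, and it is this function whose expectation is computed. *)

Lemma ge0_integral_gauss (f : R -> \bar R) : measurable_fun setT f ->
  (forall x, 0 <= f x)%E ->
  (\int[gauss]_x f x = \int[mu]_x (f x * (pdf x)%:E))%E.
Proof.
move=> mf f0; have dom := normal_prob_dominates (0 : R) 1.
rewrite -(Radon_Nikodym_SigmaFinite.change_of_variables dom)//.
have iRN := Radon_Nikodym_SigmaFinite.f_integrable dom.
have mpdf := measurable_normal_pdf (0 : R) 1.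
(* The Radon-Nikodym derivative and the density have the same integral over every measurable set, so
   they agree almost everywhere. *)
apply: ae_eq_integral => //.
- by apply: emeasurable_funM => //; exact: measurable_int iRN.
- by apply: emeasurable_funM => //; exact/measurable_EFinP.
- apply: ae_eqe_mul2l => /=; apply: integral_ae_eq => //=.
  + exact/measurable_EFinP.
  + by move=> E _ mE; rewrite -Radon_Nikodym_SigmaFinite.f_integral.
Qed.

Lemma pdfE x : pdf x = normal_peak 1 * expR (- x ^+ 2 / 2).
Proof. by rewrite normal_pdfE ?oner_neq0// /normal_fun subr0 expr1n. Qed.

(** Half of the exponent absorbs the square: [u <= expR u] with [u = x ^+ 2 / 4]. *)
Lemma sqr_expR_le (x : R) : x ^+ 2 * expR (- x ^+ 2 / 2) <= 4 * expR (- x ^+ 2 / 4).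
Proof.
have -> : - x ^+ 2 / 2 = - x ^+ 2 / 4 + - x ^+ 2 / 4 by lra.
rewrite expRD mulrA ler_wpM2r ?expR_ge0//.
have := expR_ge1Dx (x ^+ 2 / 4).
rewrite [in X in _ -> X]mulNr expRN ler_pdivrMr ?expR_gt0//; lra.
Qed.

(** The remaining half of the exponent is, up to normalisation, the density of variance 2, which is
    known to be integrable. *)
Lemma pdf_sqr_le (x : R) : x ^+ 2 * pdf x <=
  (4 * normal_peak 1 / normal_peak (Num.sqrt 2)) * normal_pdf 0 (Num.sqrt 2) x.
Proof.
have s2 : (Num.sqrt 2 : R) != 0 by rewrite gt_eqF// sqrtr_gt0.
rewrite pdfE normal_pdfE// /normal_fun subr0 sqr_sqrtr//.
rewrite (_ : 2 *+ 2 = 4) -?natrM//; last by rewrite -mulr_natr; lra.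
have p2 := normal_peak_gt0 s2.
rewrite mulrA divfK ?gt_eqF//.
rewrite mulrCA [4 * _]mulrC -[leRHS]mulrA ler_wpM2l ?normal_peak_ge0//.
exact: sqr_expR_le.
Qed.

Lemma integrable_sqr_pdf : mu.-integrable setT (fun x => ((1 + x ^+ 2) * pdf x)%:E).
Proof.
have mpdf := measurable_normal_pdf (0 : R) 1.
have -> : (fun x => ((1 + x ^+ 2) * pdf x)%:E) =
   (fun x => (pdf x)%:E) \+ (fun x => (x ^+ 2 * pdf x)%:E).
  by apply/funext => x; rewrite /= mulrDl mul1r.
apply: integrableD => //; first exact: integrable_normal_pdf.
pose c := (4 * normal_peak 1 / normal_peak (Num.sqrt 2)) : R.
have ic : mu.-integrable setT (fun x => (c * normal_pdf 0 (Num.sqrt 2) x)%:E).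
  under eq_fun do rewrite EFinM.
  by apply: integrableZl => //; exact: integrable_normal_pdf.
apply: le_integrable ic => //.
- by apply/measurable_EFinP/measurable_funM => //; exact: measurable_funX.
- move=> x _ /=; rewrite lee_fin ger0_norm.
    exact: le_trans (pdf_sqr_le x) (ler_norm _).
  by apply: mulr_ge0; [exact: sqr_ge0|exact: normal_pdf_ge0].
Qed.

Lemma integrable_gauss_sqr : gauss.-integrable setT (fun x => (1 + x ^+ 2)%:E).
Proof.
have m1 : measurable_fun setT (fun x : R => (1 + x ^+ 2)%:E).
  by apply/measurable_EFinP; apply: measurable_funD => //; exact: measurable_funX.
apply/integrableP; split=> //.
rewrite ge0_integral_gauss//; last exact: measurableT_comp.
have /integrableP[_] := integrable_sqr_pdf; apply: le_lt_trans.
apply: ge0_le_integral => //=.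
- by move=> x _; rewrite lee_fin mulr_ge0 ?normal_pdf_ge0.
- apply/measurable_EFinP/measurable_funM; last exact: measurable_normal_pdf.
  by apply: measurableT_comp => //; exact/measurable_EFinP.
- apply/measurable_EFinP/measurableT_comp => //; apply: measurable_funM => //.
    exact/measurable_EFinP.
  exact: measurable_normal_pdf.
- by move=> x _; rewrite lee_fin normrM (ger0_norm (normal_pdf_ge0 _ _ _)).
Qed.

Lemma integral_gauss (f : R -> R) : measurable_fun setT f ->
  (\int[gauss]_x (f x)%:E = \int[mu]_x (f x * pdf x)%:E)%E.
Proof.
move=> /measurable_EFinP mf.
rewrite [LHS]integralE [RHS]integralE !ge0_integral_gauss//.
- congr (_ - _)%E; apply: eq_integral => x _; rewrite ?funeposE ?funenegE /=.
  + by rewrite -EFin_max -EFinM -EFin_max maxr_pMl ?normal_pdf_ge0// mul0r.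
  + rewrite -EFin_max -EFinM -EFin_max maxr_pMl ?normal_pdf_ge0// mul0r.
    by rewrite mulNr.
- exact: measurable_funeneg.
- exact: measurable_funepos.
Qed.

(* [h] is the divergence [f' - x f] of [f] against the Gaussian weight, whose
   primitive is [f] times the density. *)
Lemma gauss_divergence (f h : R -> R) (C : R) :
  (forall x : R, is_derive x 1 f (h x + x * f x)) -> continuous h ->
  (forall x, `|x * f x| <= C * (1 + x ^+ 2)) ->
  (forall x, `|h x| <= C * (1 + x ^+ 2)) ->
  (\int[gauss]_x (h x)%:E = 0)%E.
Proof.
move=> df ch fC hC.
have mh : measurable_fun setT h by exact: continuous_measurable_fun.
rewrite integral_gauss//.
have mpdf := measurable_normal_pdf (0 : R) 1.
have dpdf (x : R) : is_derive x 1 pdf (- x * pdf x).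
  have -> : pdf = (fun y => normal_peak 1 * expR (- y ^+ 2 / 2)).
    by apply/funext => y; exact: pdfE.
  apply: is_derive_eq.
  rewrite /GRing.scale /=; lra.
have dF (x : R) : is_derive x 1 (fun x => f x * pdf x) (h x * pdf x).
  apply: is_derive_eq.
  rewrite /GRing.scale /=; lra.
have C0 : 0 <= C by have := le_trans (normr_ge0 _) (hC 0); rewrite expr0n addr0 mulr1.
(* The boundary terms decay like [1 / |x|], since [expR (- x ^+ 2 / 2) <= (1 + x ^+ 2 / 2)^-1] and
   [(1 + x ^+ 2) / (1 + x ^+ 2 / 2) <= 2]. *)
have Fle x : x != 0 -> `|f x * pdf x| <= 2 * C * normal_peak 1 / `|x|.
  move=> x0; rewrite ler_pdivlMr ?normr_gt0// -normrM mulrC mulrA normrM.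
  rewrite (ger0_norm (normal_pdf_ge0 _ _ _)) pdfE.
  have e1 : expR (- x ^+ 2 / 2) <= (1 + x ^+ 2 / 2)^-1.
    rewrite mulNr expRN lef_pV2 ?posrE ?expR_gt0 ?expR_ge1Dx//.
    by have := sqr_ge0 x; lra.
  apply: le_trans (ler_pM _ _ (fC x) (ler_wpM2l _ e1)) _ => //.
  - by rewrite mulr_ge0 ?normal_peak_ge0 ?expR_ge0.
  - by rewrite normal_peak_ge0.
  set v := (_ + _)^-1.
  have v2 : (1 + x ^+ 2) * v <= 2.
    rewrite ler_pdivrMr; have := sqr_ge0 x; lra.
  have -> : C * (1 + x ^+ 2) * (normal_peak 1 * v) =
            C * normal_peak 1 * ((1 + x ^+ 2) * v) by ring.
  have -> : 2 * C * normal_peak 1 = C * normal_peak 1 * 2 by ring.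
  by rewrite ler_wpM2l// mulr_ge0// normal_peak_ge0.
(* The integral is a limit of integrals over growing intervals, by dominated convergence; [n.+1]
   keeps each interval nondegenerate for the fundamental theorem of calculus. *)
pose I n := (`[- n.+1%:R, n.+1%:R]%classic : set R).
pose g n := (fun x => (h x * pdf x)%:E) \_ (I n).
have mhp : measurable_fun setT (fun x => (h x * pdf x)%:E).
  by apply/measurable_EFinP; exact: measurable_funM.
have [] := @dominated_convergence _ _ R mu setT measurableT g
  (fun x => (h x * pdf x)%:E) (fun x => (C * ((1 + x ^+ 2) * pdf x))%:E).
- move=> n; apply/(measurable_restrictT _ _).1 => //.
    exact: measurable_itv.
  exact: measurable_funTS.
- by [].
- apply/aeW => x _; apply: cvg_near_cst; near=> n.
  rewrite /g patchE mem_set// /I/= in_itv/= -ler_norml.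
  by rewrite -nat1r -lerBlDl; near: n; exact: nbhs_infty_ger.
- under eq_fun do rewrite EFinM.
  by apply: integrableZl => //; exact: integrable_sqr_pdf.
- apply/aeW => x n _; rewrite /g patchE; case: ifPn => _.
    rewrite lee_fin normrM (ger0_norm (normal_pdf_ge0 _ _ _)) mulrA.
    by rewrite ler_wpM2r ?normal_pdf_ge0.
  by rewrite abse0 lee_fin !mulr_ge0 ?normal_pdf_ge0// addr_ge0 ?sqr_ge0.
move=> _ _ cvg1; apply: cvg_unique cvg1 _ => //.
pose jump n := f n.+1%:R * pdf n.+1%:R - f (- n.+1%:R) * pdf (- n.+1%:R).
rewrite (_ : (fun n => _) = (fun n => (jump n)%:E)); last first.
  apply/funext => n; rewrite /g -integral_mkcond EFinB.
  apply: (@continuous_FTC2 _ _ (fun x => f x * pdf x)).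
  - by rewrite (lt_trans (y := 0))// oppr_lt0.
  - apply: continuous_subspaceT => x; apply: cvgM; first exact: ch.
    exact: continuous_normal_pdf.
  - have cF x : (fun x => f x * pdf x) y @[y --> x] --> f x * pdf x.
      have [/derivable1_diffP /differentiable_continuous] := dF x; exact.
    split.
    + by move=> x _; case: (dF x).
    + exact/cvg_at_right_filter/cF.
    + exact/cvg_at_left_filter/cF.
  - by move=> x _; rewrite derive1E; case: (dF x).
apply/fine_cvgP; split; first exact: nearW.
apply/norm_cvg0P.
apply: (@squeeze_cvgr _ _ _ _ (cst 0) (fun n => 4 * C * normal_peak 1 * n.+1%:R^-1)).
- apply: nearW => n; rewrite normr_ge0/=.
  apply: le_trans (ler_normB _ _) _.
  have := Fle n.+1%:R; have := Fle (- n.+1%:R).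
  rewrite normrN oppr_eq0 (ger0_norm (ler0n _ _)) pnatr_eq0 => /(_ isT) l1 /(_ isT) l2.
  by apply: le_trans (lerD l2 l1) _; rewrite -mulrDl ler_pM2r ?invr_gt0// -!mulrA; lra.
- exact: cvg_cst.
- rewrite -[X in _ --> X](mulr0 (4 * C * normal_peak 1)).
  exact: (cvgM (cvg_cst _) (@cvg_harmonic R)).
Unshelve. all: by end_near. 
Qed.
End gaussian_integral.

(** * Splitting one coordinate off an independent family *)

Section independence.
Context d (T : measurableType d) (R : realType) (P : probability T R).
Context (I : finType) (X : I -> {RV P >-> R}).
Hypothesis indepX : mutually_independent X.
Local Notation gauss := (@normal_prob R 0 1).
Hypothesis gaussX : forall i (B : set R), measurable B ->
  distribution P (X i) B = gauss B.

Definition box (a : I) (B : I -> set R) : set T :=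
  \bigcap_(i in [set i | i != a]) (X i @^-1` B i).

Definition boxes (a : I) : set (set T) :=
  [set box a B | B in [set B | forall i, measurable (B i)]].

(* [T] with the sigma-algebra generated by the variables other than [X a]. *)
Local Notation Toth a := (g_sigma_algebraType (boxes a)).

Lemma measurable_boxes a : boxes a `<=` @measurable _ T.
Proof.
move=> _ [B mB <-]; apply: fin_bigcap_measurable => [|i _]; first exact: finite_finset.
by rewrite -[X in measurable X]setTI; exact: measurable_funPT.
Qed.

(** The law of this identity map is [P] restricted to the coarser sigma-algebra, so that [T] itself
    serves as the space of the remaining coordinates. *)
Definition to_others a : T -> Toth a := id.

Lemma measurable_to_others a : measurable_fun setT (to_others a).
Proof.
have H := @measurability _ _ T (Toth a) setT (to_others a) (boxes a).
apply: H; first by [].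
move=> _ [B bB <-].
by rewrite setTI preimage_id; exact: measurable_boxes bB.
Qed.

HB.instance Definition _ a := isMeasurableFun.Build _ _ T (Toth a)
  (to_others a) (@measurable_to_others a).

Lemma measurable_other a b : b != a -> measurable_fun setT (X b : Toth a -> R).
Proof.
move=> ba _ B mB; rewrite setTI; apply: sub_sigma_algebra.
exists (fun i => if i == b then B else setT); first by move=> i; case: ifP.
rewrite /box; apply/seteqP; split=> [w /(_ b)/=|w /= Bw i /= ia].
  by rewrite eqxx; exact.
by case: eqP => // ->.
Qed.

Definition split_at a (w : T) : measurableTypeR R * Toth a := (X a w, to_others a w).

Lemma measurable_split_at a : measurable_fun setT (split_at a).
Proof.
apply: measurable_fun_pair; last exact: measurable_to_others.
exact: (@measurable_funPT _ _ _ _ (X a)).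
Qed.

HB.instance Definition _ a := isMeasurableFun.Build _ _ T (measurableTypeR R * Toth a)%type
  (split_at a) (@measurable_split_at a).

Local Notation Pa a := (distribution P (to_others a)).

Lemma box_indep a (A : set R) B : measurable A -> (forall i, measurable (B i)) ->
  (P (X a @^-1` A `&` box a B) = P (X a @^-1` A) * P (box a B))%E.
Proof.
move=> mA mB.
have -> : box a B = \bigcap_(i in [set` [set~ a]%SET]) (X i @^-1` B i).
  by congr (\bigcap_(i in _) _); apply/seteqP; split => i /=; rewrite !inE.
pose B' i := if i == a then A else B i.
have mB' i : measurable (B' i) by rewrite /B'; case: ifP.
have -> : X a @^-1` A `&` \bigcap_(i in [set` [set~ a]%SET]) (X i @^-1` B i) =
   \bigcap_(i in [set` [set: I]%SET]) (X i @^-1` B' i).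
  apply/seteqP; split => [w [Aw Bw] i _|w Bw].
    rewrite /B' /preimage/=; case: eqP => [->//|/eqP ia].
    by apply: Bw; rewrite /= !inE.
  split; first by have := Bw a; rewrite /= inE /B' /preimage/= eqxx; exact.
  move=> i /=; rewrite !inE => ia.
  by have := Bw i; rewrite /= inE /B' /preimage/= (negbTE ia); exact.
rewrite !indepX// (bigD1 a) ?inE//= {1}/B' eqxx; congr (_ * _)%E.
apply: eq_big => [i|i]; first by rewrite !inE.
by rewrite inE /= /B' => /negbTE ->.
Qed.

(** For fixed [A] both sides are finite measures in [B] that agree on boxes by independence. Boxes
    are stable under intersection and generate the sigma-algebra, so the measures coincide. *)
Lemma split_at_indep a (A : set R) (B : set (Toth a)) :
  measurable A -> measurable B ->
  (distribution P (split_at a) (A `*` B) = gauss A * Pa a B)%E.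
Proof.
move=> mA mB.
have mXA : measurable (X a @^-1` A).
  by rewrite -[X in measurable X]setTI; exact: measurable_funPT.
rewrite -(gaussX a mA) /distribution /pushforward /=.
have [r r0 rE] : exists2 r : R, 0 <= r & r%:E = P (X a @^-1` A).
  exists (fine (P (X a @^-1` A))); first by rewrite fine_ge0.
  by rewrite fineK// fin_num_measure.
pose m1' : {measure set (Toth a) -> \bar R} :=
  pushforward (mrestr P mXA) (to_others a).
pose m1 := m1' (@measurable_to_others a).
pose m2 : {measure set (Toth a) -> \bar R} := mscale (NngNum r0) (Pa a).
have : m1 B = m2 B.
  apply: (@measure_unique _ R (Toth a) (boxes a) (fun=> setT)) => //.
  - move=> _ _ [B1 mB1 <-] [B2 mB2 <-].
    exists (fun i => B1 i `&` B2 i); first by move=> i; exact: measurableI.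
    by rewrite /box -bigcapI; apply: eq_bigcapr => i _; rewrite preimage_setI.
  - move=> _; exists (fun=> setT) => //.
    by apply/seteqP; split.
  - by rewrite bigcup_const.
  - move=> _ [C mC <-]; rewrite /m1 /m1' /m2 /mscale/= /pushforward/= /mrestr.
    by rewrite preimage_id setIC box_indep// /mscale/= rE.
  - move=> _; rewrite /m1 /m1' /pushforward/= /mrestr.
    rewrite (le_lt_trans (probability_le1 _ _))  ?ltry//; apply: measurableI => //.
    by rewrite -[X in measurable X]setTI; exact: measurable_to_others.
rewrite /m1 /m1' /m2/= /mscale/= /distribution /pushforward/= /mrestr => h.
by rewrite -rE -h setIC; congr (P _).
Qed.

(** The joint law of the coordinate and the rest is a product measure, so Fubini allows the integral
    over the coordinate [a] to be taken first. *)
Lemma integral_split_at0 a (f : measurableTypeR R * Toth a -> \bar R) :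
  measurable_fun setT f -> P.-integrable setT (f \o split_at a) ->
  (forall w, \int[gauss]_x f (x, w) = 0)%E ->
  (\int[P]_w f (split_at a w) = 0)%E.
Proof.
move=> mf fi f0.
have E S : measurable S -> (gauss \x Pa a)%E S = distribution P (split_at a) S.
  move=> mS; apply: (product_measure_unique (m' := distribution P (split_at a))) => //.
  exact: split_at_indep.
have fprod : (gauss \x Pa a)%E.-integrable setT f.
  apply/integrableP; split=> //.
  rewrite (eq_measure_integral (distribution P (split_at a))); last first.
    by move=> S mS _; exact: E.
  rewrite ge0_integral_distribution//; last exact: measurableT_comp.
  by have /integrableP[_] := fi.
transitivity (\int[distribution P (split_at a)]_z f z)%E.
  by rewrite integral_distribution.
transitivity (\int[(gauss \x Pa a)%E]_z f z)%E.
  by apply: eq_measure_integral => S mS _; exact/esym/E.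
rewrite -integral21_prod_meas1// /fubini_G.
by under eq_integral do rewrite f0; rewrite integral0.
Qed.

End independence.

(** * Stein's identity in one coordinate of a Gaussian family *)

Section stein.
Context d (T : measurableType d) (R : realType) (P : probability T R).
Context (I : finType) (X : I -> {RV P >-> R}).
Hypothesis indepX : mutually_independent X.
Local Notation gauss := (@normal_prob R 0 1).
Hypothesis gaussX : forall i (B : set R), measurable B ->
  distribution P (X i) B = gauss B.

(* Borel measurability of [h], phrased without a sigma-algebra on [I -> R]. *)
Definition borel_fun (h : (I -> R) -> R) : Prop :=
  forall d' (S : measurableType d') (v : S -> I -> R),
    (forall i, measurable_fun setT (fun s => v s i)) ->
    measurable_fun setT (fun s => h (v s)).

Definition quad_growth (h : (I -> R) -> R) : Prop :=
  exists C, forall v, `|h v| <= C * (1 + \sum_i v i ^+ 2).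

Definition upd (v : I -> R) (a : I) (x : R) : I -> R :=
  fun i => if i == a then x else v i.

Local Notation Xv w := (fun i => X i w).

(* [normal_prob] lives on the alias [measurableTypeR R] of [R]. *)
Definition alias_RV i : T -> measurableTypeR R := X i.

Lemma measurable_alias_RV i : measurable_fun setT (alias_RV i).
Proof. exact: (@measurable_funPT _ _ _ _ (X i)). Qed.

HB.instance Definition _ i := isMeasurableFun.Build _ _ T (measurableTypeR R)
  (alias_RV i) (@measurable_alias_RV i).

Lemma integrable_sqr_RV i : P.-integrable setT (fun w => (X i w ^+ 2)%:E).
Proof.
have m2 : measurable_fun setT (fun x : measurableTypeR R => (`|x ^+ 2|)%:E).
  by apply/measurable_EFinP/measurableT_comp => //; exact: measurable_funX.
have mX2 : measurable_fun setT (fun w => (X i w ^+ 2)%:E).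
  by apply/measurable_EFinP; apply: measurable_funX; exact: measurable_funPT.
apply/integrableP; split=> //.
rewrite -[ltLHS](@ge0_integral_distribution _ _ _ _ _ P (alias_RV i) _ m2)//.
rewrite (eq_measure_integral gauss); last by move=> S mS _; exact: gaussX.
have /integrableP[_] := @integrable_gauss_sqr R; apply: le_lt_trans.
apply: ge0_le_integral => //=.
- apply/measurable_EFinP/measurableT_comp => //.
  by apply: measurable_funD => //; exact: measurable_funX.
- move=> x _; rewrite lee_fin !ger0_norm ?sqr_ge0//; have := sqr_ge0 x; lra.
Qed.

Lemma integrable_quad_growth h : borel_fun h -> quad_growth h ->
  P.-integrable setT (fun w => (h (Xv w))%:E).
Proof.
move=> bh [C hC].
have iq : P.-integrable setT
    (fun w => C%:E * (1%:E + \sum_i (X i w ^+ 2)%:E))%E.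
  apply: integrableZl => //; apply: integrableD => //.
    exact: finite_measure_integrable_cst.
  by apply: integrable_sum => // i _; exact: integrable_sqr_RV.
apply: le_integrable iq => //.
  by apply/measurable_EFinP; apply: bh => i.
move=> w _; rewrite sumEFin -EFinD -EFinM lee_fin.
exact: le_trans (hC _) (ler_norm _).
Qed.

(** Here [h] is the partial derivative of [f] in the coordinate [a] minus [v a * f v]. With the
    other coordinates frozen its Gaussian integral vanishes by the one-dimensional case. *)
Lemma stein (a : I) (f h : (I -> R) -> R) :
  borel_fun h ->
  (forall v (x : R), is_derive x 1 (fun y => f (upd v a y))
    (h (upd v a x) + x * f (upd v a x))) ->
  (forall v, continuous (fun x => h (upd v a x))) ->
  quad_growth (fun v => v a * f v) -> quad_growth h ->
  (\int[P]_w (h (Xv w))%:E = 0)%E.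
Proof.
move=> bh df ch [C1 fC] hqg.
have [C2 hC] := hqg.
have updE w : upd (Xv w) a (X a w) = Xv w.
  by apply/funext => i; rewrite /upd; case: eqP => // ->.
pose F (z : measurableTypeR R * g_sigma_algebraType (boxes X a)) :=
  (h (upd (Xv (z.2 : T)) a z.1))%:E.
transitivity (\int[P]_w F (split_at X a w))%E.
  by apply: eq_integral => w _; rewrite /F /= updE.
apply: (integral_split_at0 indepX gaussX).
- apply/measurable_EFinP; apply: bh => i; rewrite /upd; case: eqP => [_|/eqP ia].
    exact: measurable_fst.
  have mo := @measurable_other _ _ _ _ _ X _ _ ia.
  exact: (measurableT_comp mo measurable_snd).
- have := integrable_quad_growth bh hqg; apply: eq_integrable => // w _.
  by rewrite /F /= updE.
- move=> w; rewrite /F /=.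
  set v := Xv w.
  pose S := \sum_(i | i != a) v i ^+ 2.
  have S0 : 0 <= S by apply: sumr_ge0 => i _; exact: sqr_ge0.
  have Supd x : \sum_i (upd v a x) i ^+ 2 = x ^+ 2 + S.
    rewrite (bigD1 a)//= /upd eqxx; congr (_ + _).
    by apply: eq_bigr => i /negbTE ->.
  have upda x : upd v a x a = x by rewrite /upd eqxx.
  pose C := (`|C1| + `|C2|) * (1 + S).
  have bnd D x : D <= `|C1| + `|C2| -> D * (1 + (x ^+ 2 + S)) <= C * (1 + x ^+ 2).
    move=> hD; have x0 := sqr_ge0 x.
    rewrite /C -mulrA; apply: (@le_trans _ _ ((`|C1| + `|C2|) * (1 + (x ^+ 2 + S)))).
      by rewrite ler_wpM2r// !addr_ge0.
    by rewrite ler_wpM2l ?addr_ge0//; nra.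
  apply: (@gauss_divergence R (fun x => f (upd v a x)) (fun x => h (upd v a x)) C).
  + exact: (ch v).
  + move=> x; have := fC (upd v a x); rewrite upda Supd => /le_trans; apply.
    by apply: bnd; have := ler_norm C1; have := normr_ge0 C2; lra.
  + move=> x; have := hC (upd v a x); rewrite Supd => /le_trans; apply.
    by apply: bnd; have := ler_norm C2; have := normr_ge0 C1; lra.
Qed.

End stein.

(** * Classes of functions closed under rational operations, and matrices over them *)

Section closed_class.
Context {R : realType} (S : Type) (Q : (S -> R) -> Prop).
Hypothesis Q_cst : forall c, Q (fun=> c).
Hypothesis QD : forall f g, Q f -> Q g -> Q (fun s => f s + g s).
Hypothesis QM : forall f g, Q f -> Q g -> Q (fun s => f s * g s).
Hypothesis QV : forall f, (forall s, f s != 0) -> Q f -> Q (fun s => (f s)^-1).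

Definition entrywise p q (M : S -> 'M[R]_(p, q)) : Prop :=
  forall i j, Q (fun s => M s i j).

Lemma closed_sum (J : Type) (e : seq J) (p : pred J) (F : J -> S -> R) :
  (forall j, Q (F j)) -> Q (fun s => \sum_(j <- e | p j) F j s).
Proof.
move=> QF; elim: e => [|j e IH].
  by under eq_fun do rewrite big_nil; exact: Q_cst.
under eq_fun do rewrite big_cons.
by case: (p j) => //; exact: QD.
Qed.

Lemma closed_prod (J : Type) (e : seq J) (p : pred J) (F : J -> S -> R) :
  (forall j, Q (F j)) -> Q (fun s => \prod_(j <- e | p j) F j s).
Proof.
move=> QF; elim: e => [|j e IH].
  by under eq_fun do rewrite big_nil; exact: Q_cst.
under eq_fun do rewrite big_cons.
by case: (p j) => //; exact: QM.
Qed.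

Lemma entrywise_cst p q (M : 'M[R]_(p, q)) : entrywise (fun=> M).
Proof. by move=> i j; exact: Q_cst. Qed.

Lemma entrywise_add p q (M N : S -> 'M[R]_(p, q)) :
  entrywise M -> entrywise N -> entrywise (fun s => M s + N s).
Proof.
move=> QM' QN i j; under eq_fun do rewrite mxE; exact: QD (QM' i j) (QN i j).
Qed.

Lemma entrywise_tr p q (M : S -> 'M[R]_(p, q)) :
  entrywise M -> entrywise (fun s => (M s)^T).
Proof. by move=> QM' i j; under eq_fun do rewrite mxE; exact: QM'. Qed.

Lemma entrywise_mul p q r (M : S -> 'M[R]_(p, q)) (N : S -> 'M[R]_(q, r)) :
  entrywise M -> entrywise N -> entrywise (fun s => M s *m N s).
Proof.
move=> QM' QN i j; under eq_fun do rewrite mxE.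
by apply: closed_sum => k; exact: QM.
Qed.

Lemma entrywise_opp p q (M : S -> 'M[R]_(p, q)) :
  entrywise M -> entrywise (fun s => - M s).
Proof.
move=> QM' i j; under eq_fun do rewrite mxE -mulN1r.
by apply: QM => //; exact: QM'.
Qed.

Lemma closed_det p (M : S -> 'M[R]_p) : entrywise M -> Q (fun s => \det (M s)).
Proof.
move=> QM'; apply: closed_sum => s; apply: QM => //.
by apply: closed_prod => i; exact: QM'.
Qed.

Lemma closed_trace p (M : S -> 'M[R]_p) : entrywise M -> Q (fun s => \tr (M s)).
Proof. by move=> QM'; apply: closed_sum => i; exact: QM'. Qed.

(** Cramer's rule: the entries are cofactors over the determinant, so only a nowhere vanishing
    function has to be inverted. *)
Lemma entrywise_inv p (M : S -> 'M[R]_p) : (forall s, M s \in unitmx) ->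
  entrywise M -> entrywise (fun s => invmx (M s)).
Proof.
move=> uM QM' i j; under eq_fun do rewrite /invmx uM !mxE.
apply: QM.
  apply: QV; last exact: closed_det.
  by move=> s; have := uM s; rewrite unitmxE unitfE.
apply: QM => //; apply: closed_det => k m.
by under eq_fun do rewrite !mxE; exact: QM'.
Qed.

End closed_class.

Lemma measurable_fun_inv d (S : measurableType d) (R : realType) (f : S -> R) :
  (forall s, f s != 0) ->
  measurable_fun setT f -> measurable_fun setT (fun s => (f s)^-1).
Proof.
move=> f0 mf.
(* The power with exponent -1 is the inverse on nonnegative arguments, hence the detour through
   [f s ^+ 2]. *)
have -> : (fun s => (f s)^-1) = (fun s => f s * ((f s ^+ 2) `^ (-1))).
  apply/funext => s; rewrite powR_inv1 ?sqr_ge0// expr2 invfM mulrA divff ?mul1r//.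
apply: measurable_funM => //.
apply: (@measurableT_comp _ _ _ _ _ _ (fun x => x `^ (-1))).
  exact: measurable_powR.
exact: measurable_funX.
Qed.

(** * Entrywise derivatives of matrix functions of a real variable *)

Definition derivable_all {R : realType} (f : R -> R) := forall t : R, derivable f t 1.

Lemma derivable_all_continuous {R : realType} (f : R -> R) :
  derivable_all f -> continuous f.
Proof.
by move=> df t; have /derivable1_diffP/differentiable_continuous := df t.
Qed.

Lemma derivable_all_cst {R : realType} (c : R) : derivable_all (fun=> c).
Proof. by move=> t; exact: derivable_cst. Qed.

Lemma derivable_all_add {R : realType} (f g : R -> R) :
  derivable_all f -> derivable_all g -> derivable_all (fun t => f t + g t).
Proof. by move=> df dg t; exact: derivableD. Qed.

Lemma derivable_all_mul {R : realType} (f g : R -> R) :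
  derivable_all f -> derivable_all g -> derivable_all (fun t => f t * g t).
Proof. by move=> df dg t; exact: derivableM. Qed.

Lemma derivable_all_inv {R : realType} (f : R -> R) : (forall t, f t != 0) ->
  derivable_all f -> derivable_all (fun t => (f t)^-1).
Proof. by move=> f0 df t; exact: derivableV. Qed.

Definition mderiv {R : realType} p q (M : R -> 'M[R]_(p, q)) (t : R)
    (M' : 'M[R]_(p, q)) : Prop :=
  forall i j, is_derive t 1 (fun s => M s i j) (M' i j).

Section mderiv.
Context {R : realType}.
Implicit Types (t : R).

Lemma is_derive_bigsum (J : Type) (e : seq J) (F : J -> R -> R) (F' : J -> R) t :
  (forall j, is_derive t 1 (F j) (F' j)) ->
  is_derive t 1 (fun s => \sum_(j <- e) F j s) (\sum_(j <- e) F' j).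
Proof.
move=> dF; elim: e => [|j e IH].
  by under eq_fun do rewrite big_nil; rewrite big_nil; exact: is_derive_cst.
under eq_fun do rewrite big_cons; rewrite big_cons.
exact: is_deriveD.
Qed.

Lemma mderiv_cst p q (M : 'M[R]_(p, q)) t : mderiv (fun=> M) t 0.
Proof. by move=> i j; rewrite mxE; exact: is_derive_cst. Qed.

Lemma mderiv_add p q (M N : R -> 'M[R]_(p, q)) t M' N' :
  mderiv M t M' -> mderiv N t N' -> mderiv (fun s => M s + N s) t (M' + N').
Proof.
move=> dM dN i j; under eq_fun do rewrite mxE; rewrite mxE.
exact: is_deriveD (dM i j) (dN i j).
Qed.

Lemma mderiv_tr p q (M : R -> 'M[R]_(p, q)) t M' :
  mderiv M t M' -> mderiv (fun s => (M s)^T) t M'^T.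
Proof. by move=> dM i j; under eq_fun do rewrite mxE; rewrite mxE. Qed.

Lemma mderiv_mul p q r (M : R -> 'M[R]_(p, q)) (N : R -> 'M[R]_(q, r)) t M' N' :
  mderiv M t M' -> mderiv N t N' ->
  mderiv (fun s => M s *m N s) t (M' *m N t + M t *m N').
Proof.
move=> dM dN i j; under eq_fun do rewrite mxE; rewrite !mxE -big_split/=.
apply: is_derive_bigsum => k; apply: is_derive_eq (is_deriveM (dM i k) (dN k j)) _.
by rewrite /GRing.scale/= addrC [M' i k * _]mulrC.
Qed.

Lemma mderiv_unique p q (M : R -> 'M[R]_(p, q)) t M' M'' :
  mderiv M t M' -> mderiv M t M'' -> M' = M''.
Proof.
move=> d1 d2; apply/matrixP => i j.
by have [_ <-] := d1 i j; have [_ <-] := d2 i j.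
Qed.

(** Cramer's rule gives differentiability of the inverse; the value of the derivative follows by
    differentiating [invmx (M s) *m M s = 1%:M]. *)
Lemma mderiv_inv p (M : R -> 'M[R]_p) t M' : (forall s, M s \in unitmx) ->
  (forall i j, derivable_all (fun s => M s i j)) -> mderiv M t M' ->
  mderiv (fun s => invmx (M s)) t (- (invmx (M t) *m M' *m invmx (M t))).
Proof.
move=> uM aM dM.
have dK : entrywise derivable_all (fun s => invmx (M s)).
  exact: (entrywise_inv (@derivable_all_cst _) (@derivable_all_add _)
    (@derivable_all_mul _) (@derivable_all_inv _) uM aM).
pose K' : 'M[R]_p := \matrix_(i, j) 'D_1 (fun s => invmx (M s) i j) t.
have dK' : mderiv (fun s => invmx (M s)) t K'.
  by move=> i j; rewrite mxE; apply: DeriveDef => //; exact: dK.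
have := mderiv_mul dK' dM.
under eq_fun do rewrite mulVmx//.
move=> /mderiv_unique /(_ (@mderiv_cst p p 1%:M t)) /eqP.
rewrite addr_eq0 => /eqP /(congr1 (mulmx^~ (invmx (M t)))).
by rewrite mulmxK// mulNmx => <-.
Qed.

End mderiv.

(** * The squared Frobenius norm *)

Section frobenius.
Context {R : realType}.

Definition frob p q (M : 'M[R]_(p, q)) : R := \tr (M^T *m M).

Lemma frobE p q (M : 'M[R]_(p, q)) : frob M = \sum_j \sum_i M i j ^+ 2.
Proof.
rewrite /frob /mxtrace; apply: eq_bigr => j _; rewrite mxE.
by apply: eq_bigr => i _; rewrite mxE expr2.
Qed.

Lemma frob_ge0 p q (M : 'M[R]_(p, q)) : 0 <= frob M.
Proof.
by rewrite frobE; apply: sumr_ge0 => j _; apply: sumr_ge0 => i _; exact: sqr_ge0.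
Qed.

Lemma sqr_entry_le_frob p q (M : 'M[R]_(p, q)) i j : M i j ^+ 2 <= frob M.
Proof.
rewrite frobE (bigD1 j)//= (bigD1 i)//= -addrA lerDl addr_ge0//.
  by apply: sumr_ge0 => k _; exact: sqr_ge0.
by apply: sumr_ge0 => k _; apply: sumr_ge0 => m _; exact: sqr_ge0.
Qed.

Lemma frob_tr p q (M : 'M[R]_(p, q)) : frob M^T = frob M.
Proof. by rewrite /frob trmxK mxtrace_mulC. Qed.

Lemma frob_eq0 p q (M : 'M[R]_(p, q)) : frob M = 0 -> M = 0.
Proof.
move=> M0; apply/matrixP => i j; rewrite mxE; apply/eqP.
by rewrite -sqrf_eq0 eq_le sqr_ge0 andbT -M0 sqr_entry_le_frob.
Qed.

End frobenius.

(** * The regularised Gram matrix and the ridge pseudo-inverse *)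

Section resolvent.
Context {R : realType} (r l : nat) (eps : R).
Hypothesis eps_gt0 : 0 < eps.
Variable Z : 'M[R]_(r, l).

Definition reg_gram : 'M[R]_r := Z *m Z^T + eps%:M.
Definition resolvent : 'M[R]_r := invmx reg_gram.
Local Notation G := reg_gram.
Local Notation K := resolvent.

(** A row [u] with [u G = 0] satisfies [0 = u G u^T = |u Z|^2 + eps |u|^2], hence vanishes. *)
Lemma reg_gram_unit : G \in unitmx.
Proof.
rewrite -row_free_unit; apply: inj_row_free => u uG.
have : frob (u *m Z)^T + eps * frob u^T = 0.
  have : \tr (u *m G *m u^T) = 0 by rewrite uG mul0mx mxtrace0.
  rewrite /frob !trmxK trmx_mul /G mulmxDr mulmxDl mxtraceD !mulmxA => <-.
  by rewrite mul_mx_scalar -scalemxAl mxtraceZ.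
move/eqP; rewrite paddr_eq0 ?frob_ge0//; last by rewrite mulr_ge0 ?frob_ge0// ltW.
case/andP => _; rewrite mulf_eq0 gt_eqF//= => /eqP /frob_eq0 /(congr1 trmx).
by rewrite trmxK trmx0.
Qed.

Lemma reg_gram_tr : G^T = G.
Proof. by rewrite /G linearD/= trmx_mul trmxK tr_scalar_mx. Qed.

Lemma resolvent_tr : K^T = K.
Proof. by rewrite /K trmx_inv reg_gram_tr. Qed.

Lemma resolvent_gram : K *m (Z *m Z^T) = 1%:M - eps *: K.
Proof.
apply/eqP; rewrite eq_sym subr_eq -mul_mx_scalar -mulmxDr mulVmx//.
exact: reg_gram_unit.
Qed.

Lemma gram_resolvent : Z *m Z^T *m K = 1%:M - eps *: K.
Proof.
have := congr1 trmx resolvent_gram.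
by rewrite trmx_mul resolvent_tr trmx_mul trmxK linearB/= linearZ/= trmx1 resolvent_tr.
Qed.

(** The transpose of the ridge pseudo-inverse [Z^T K], since [K] is symmetric. *)
Definition ridge : 'M[R]_(r, l) := K *m Z.
Local Notation W := ridge.

(** This is [K = K G K], from which the bounds on [W] and [K] in terms of the trace of [K]
    derive. *)
Lemma resolvent_split : K = W *m W^T + eps *: (K *m K).
Proof.
rewrite /W trmx_mul resolvent_tr !mulmxA -(mulmxA K Z) resolvent_gram.
by rewrite mulmxBl mul1mx -scalemxAl subrK.
Qed.

Lemma tr_resolvent : \tr K = frob W + eps * frob K.
Proof.
by rewrite {1}resolvent_split mxtraceD mxtraceZ mxtrace_mulC /frob resolvent_tr.
Qed.

Lemma tr_resolvent_ge0 : 0 <= \tr K.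
Proof. by rewrite tr_resolvent addr_ge0 ?mulr_ge0 ?frob_ge0// ltW. Qed.

Lemma frob_ridge_le : frob W <= \tr K.
Proof. by rewrite tr_resolvent lerDl mulr_ge0 ?frob_ge0// ltW. Qed.

Lemma frob_resolvent_le : eps * frob K <= \tr K.
Proof. by rewrite tr_resolvent lerDr frob_ge0. Qed.

(** The diagonal of [K = W W^T + eps K K] gives [eps * K i i ^+ 2 <= K i i], hence
    [K i i <= 1 / eps], without diagonalising [K]. *)
Lemma tr_resolvent_le : \tr K <= r%:R / eps.
Proof.
rewrite -[r in leRHS]card_ord -sumr_const mulr_suml; apply: ler_sum => i _.
rewrite mul1r -[leRHS]mul1r ler_pdivlMr//.
have : eps * K i i ^+ 2 <= K i i.
  rewrite [in leRHS]resolvent_split !mxE.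
  have -> : \sum_j K i j * K j i = \sum_j K i j ^+ 2.
    apply: eq_bigr => j _; rewrite expr2; congr (_ * _).
    by rewrite -[in LHS]resolvent_tr mxE.
  rewrite -[leLHS]add0r lerD//.
    by apply: sumr_ge0 => j _; rewrite [W^T _ _]mxE -expr2 sqr_ge0.
  rewrite ler_pM2l// (bigD1 i)//= lerDl.
  by apply: sumr_ge0 => j _; exact: sqr_ge0.
have [K0|K0] := leP (K i i) 0.
  by move=> _; rewrite (le_trans _ ler01)// mulr_le0_ge0// ltW.
by rewrite expr2 mulrA -{3}[K i i]mul1r ler_pM2r// mulrC.
Qed.

(** The hat matrix of ridge regression: a damped form of the orthogonal projector onto the row space
    of [Z], with [Q - Q^2 = eps W^T W]. *)
Definition hat_mx : 'M[R]_l := Z^T *m W.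
Local Notation Q := hat_mx.

Lemma hat_mx_tr : Q^T = Q.
Proof. by rewrite /Q /W trmx_mul trmx_mul resolvent_tr trmxK mulmxA. Qed.

Lemma tr_hat_mx : \tr Q = r%:R - eps * \tr K.
Proof.
rewrite /Q mxtrace_mulC -mulmxA resolvent_gram raddfB/= mxtraceZ.
by rewrite mxtrace1.
Qed.

Lemma tr_hat_mx_le : \tr Q <= r%:R.
Proof. by rewrite tr_hat_mx gerBl mulr_ge0 ?tr_resolvent_ge0// ltW. Qed.

Lemma hat_mx_split : Q = Q^T *m Q + eps *: (W^T *m W).
Proof.
have -> : Q^T *m Q = Z^T *m (K *m (Z *m Z^T)) *m W.
  by rewrite hat_mx_tr /Q /W !mulmxA.
rewrite resolvent_gram mulmxBr mulmx1 mulmxBl -/Q -scalemxAr -scalemxAl.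
by rewrite /W trmx_mul resolvent_tr subrK.
Qed.

Lemma frob_hat_mx_le : frob Q <= r%:R.
Proof.
apply: le_trans tr_hat_mx_le.
rewrite {2}hat_mx_split mxtraceD mxtraceZ lerDl mulr_ge0 ?frob_ge0//.
exact: ltW.
Qed.

(** The derivative of [K Z] in the direction [dZ], obtained from [dK = - K (dZ Z^T + Z dZ^T) K]. *)
Definition dridge (dZ : 'M[R]_(r, l)) : 'M[R]_(r, l) :=
  K *m dZ *m (1%:M - Q) - W *m dZ^T *m W.

Definition ridge_gram : 'M[R]_l := W^T *m W.

Lemma tr_ridge_gram_le : \tr ridge_gram <= \tr K.
Proof. exact: frob_ridge_le. Qed.

End resolvent.

Section resolvent_deriv.
Context {R : realType} (r l : nat) (eps : R).
Hypothesis eps_gt0 : 0 < eps.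
Variables (Z : R -> 'M[R]_(r, l)) (t : R) (dZ : 'M[R]_(r, l)).
Hypothesis aZ : forall i j, derivable_all (fun s => Z s i j).
Hypothesis dZ_ : mderiv Z t dZ.

Lemma derivable_reg_gram i j : derivable_all (fun s => reg_gram eps (Z s) i j).
Proof.
apply: (entrywise_add (@derivable_all_add _)).
  apply: (entrywise_mul (@derivable_all_cst _) (@derivable_all_add _)
    (@derivable_all_mul _) aZ).
  exact: entrywise_tr aZ.
exact: (entrywise_cst (@derivable_all_cst _)).
Qed.

Local Notation K := (resolvent eps (Z t)).
Local Notation W := (ridge eps (Z t)).
Local Notation Q := (hat_mx eps (Z t)).

Lemma mderiv_ridge : mderiv (fun s => ridge eps (Z s)) t (dridge eps (Z t) dZ).
Proof.
have dG : mderiv (fun s => reg_gram eps (Z s)) t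
    (dZ *m (Z t)^T + Z t *m dZ^T + 0).
  apply: mderiv_add; last exact: mderiv_cst.
  by apply: mderiv_mul => //; exact: mderiv_tr.
have dK := mderiv_inv (fun s => reg_gram_unit eps_gt0 (Z s)) derivable_reg_gram dG.
have := mderiv_mul dK dZ_; congr mderiv.
rewrite addr0 /dridge mulNmx.
have -> : invmx (reg_gram eps (Z t)) *m (dZ *m (Z t)^T + Z t *m dZ^T) *m
    invmx (reg_gram eps (Z t)) *m Z t = K *m dZ *m Q + W *m dZ^T *m W.
  by rewrite mulmxDr !mulmxDl /hat_mx /ridge !mulmxA.
by rewrite mulmxBr mulmx1 opprD addrC addrA.
Qed.

End resolvent_deriv.

(** * Rational matrix maps *)

Definition alg_class {R : realType} (S : Type) (Q : (S -> R) -> Prop) : Prop :=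
  [/\ forall c, Q (fun=> c),
      forall f g, Q f -> Q g -> Q (fun s => f s + g s),
      forall f g, Q f -> Q g -> Q (fun s => f s * g s)
    & forall f, (forall s, f s != 0) -> Q f -> Q (fun s => (f s)^-1)].

(* Such a map preserves entrywise measurability and entrywise derivability. *)
Definition rational_map {R : realType} p q p' q'
    (F : 'M[R]_(p, q) -> 'M[R]_(p', q')) : Prop :=
  forall (S : Type) (Q : (S -> R) -> Prop), alg_class Q ->
    forall M : S -> 'M[R]_(p, q), entrywise Q M -> entrywise Q (fun s => F (M s)).

Section rational_map.
Context {R : realType} (p q : nat).

Lemma rational_id : rational_map (@id 'M[R]_(p, q)).
Proof. by []. Qed.

Lemma rational_cst p' q' (C : 'M[R]_(p', q')) :
  rational_map (fun _ : 'M[R]_(p, q) => C).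
Proof. by move=> S Q [Qc _ _ _] M _; exact: entrywise_cst. Qed.

Lemma rational_add p' q' (F G : 'M[R]_(p, q) -> 'M[R]_(p', q')) :
  rational_map F -> rational_map G -> rational_map (fun X => F X + G X).
Proof.
move=> rF rG S Q aQ M QM; have [_ QD _ _] := aQ.
exact: (entrywise_add QD (rF _ _ aQ _ QM) (rG _ _ aQ _ QM)).
Qed.

Lemma rational_opp p' q' (F : 'M[R]_(p, q) -> 'M[R]_(p', q')) :
  rational_map F -> rational_map (fun X => - F X).
Proof.
move=> rF S Q aQ M QM; have [Qc _ Qm _] := aQ.
exact: (entrywise_opp Qc Qm (rF _ _ aQ _ QM)).
Qed.

Lemma rational_tr p' q' (F : 'M[R]_(p, q) -> 'M[R]_(p', q')) :
  rational_map F -> rational_map (fun X => (F X)^T).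
Proof. by move=> rF S Q aQ M QM; exact: (entrywise_tr (rF _ _ aQ _ QM)). Qed.

Lemma rational_mul p' q' s (F : 'M[R]_(p, q) -> 'M[R]_(p', q'))
    (G : 'M[R]_(p, q) -> 'M[R]_(q', s)) :
  rational_map F -> rational_map G -> rational_map (fun X => F X *m G X).
Proof.
move=> rF rG S Q aQ M QM; have [Qc QD Qm _] := aQ.
exact: (entrywise_mul Qc QD Qm (rF _ _ aQ _ QM) (rG _ _ aQ _ QM)).
Qed.

Lemma rational_inv p' (F : 'M[R]_(p, q) -> 'M[R]_p') :
  (forall X, F X \in unitmx) -> rational_map F -> rational_map (fun X => invmx (F X)).
Proof.
move=> uF rF S Q aQ M QM; have [Qc QD Qm QV] := aQ.
exact: (entrywise_inv Qc QD Qm QV (fun s => uF (M s)) (rF _ _ aQ _ QM)).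
Qed.

End rational_map.

Lemma measurable_alg_class {R : realType} d (S : measurableType d) :
  alg_class (fun f : S -> R => measurable_fun setT f).
Proof.
split=> [c|f g mf mg|f g mf mg|f f0 mf].
- exact: measurable_cst.
- exact: measurable_funD.
- exact: measurable_funM.
- exact: measurable_fun_inv.
Qed.

Lemma derivable_alg_class {R : realType} : alg_class (@derivable_all R).
Proof.
split; [exact: derivable_all_cst|exact: derivable_all_add|
  exact: derivable_all_mul|exact: derivable_all_inv].
Qed.

(** * Polynomial growth of matrix maps *)

Section growth.
Context {R : realType} (n l : nat).
Local Notation MX := 'M[R]_(n, l).

(** The 1 under the root makes the powers increase with the exponent, and turns the square into the
    weight [1 + frob X] of quadratic growth. *)
Definition mxsize (X : MX) : R := Num.sqrt (1 + frob X).

Lemma mxsize_sqr X : mxsize X ^+ 2 = 1 + frob X.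
Proof. by rewrite sqr_sqrtr// addr_ge0 ?frob_ge0. Qed.

Lemma mxsize_ge1 X : 1 <= mxsize X.
Proof. by rewrite -[leLHS]sqrtr1 ler_wsqrtr// lerDl frob_ge0. Qed.

Lemma entry_le_mxsize (X : MX) i j : `|X i j| <= mxsize X.
Proof.
rewrite -sqrtr_sqr ler_wsqrtr// (le_trans (sqr_entry_le_frob X i j))//.
by rewrite lerDr.
Qed.

Definition grows k p q (F : MX -> 'M[R]_(p, q)) : Prop :=
  exists c, forall (X : MX) i j, `|F X i j| <= c * mxsize X ^+ k.

Lemma growsW k k' p q (F : MX -> 'M[R]_(p, q)) : (k <= k')%N ->
  grows k F -> grows k' F.
Proof.
move=> kk' [c hc]; exists `|c| => X i j; apply: le_trans (hc X i j) _.
have s1 := mxsize_ge1 X; have s0 := le_trans ler01 s1.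
apply: (@le_trans _ _ (`|c| * mxsize X ^+ k)).
  by rewrite ler_wpM2r ?exprn_ge0// ler_norm.
by rewrite ler_wpM2l// ler_weXn2l.
Qed.

Lemma grows_cst p q (C : 'M[R]_(p, q)) : grows 0 (fun=> C).
Proof.
exists (Num.sqrt (frob C)) => X i j; rewrite expr0 mulr1 -sqrtr_sqr.
by rewrite ler_wsqrtr// sqr_entry_le_frob.
Qed.

Lemma grows_id : grows 1 id.
Proof. by exists 1 => X i j; rewrite mul1r expr1 entry_le_mxsize. Qed.

Lemma grows_add k p q (F G : MX -> 'M[R]_(p, q)) :
  grows k F -> grows k G -> grows k (fun X => F X + G X).
Proof.
move=> [c hc] [c' hc']; exists (c + c') => X i j; rewrite mxE mulrDl.
by apply: le_trans (ler_normD _ _) _; exact: lerD.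
Qed.

Lemma grows_opp k p q (F : MX -> 'M[R]_(p, q)) :
  grows k F -> grows k (fun X => - F X).
Proof. by move=> [c hc]; exists c => X i j; rewrite mxE normrN. Qed.

Lemma grows_tr k p q (F : MX -> 'M[R]_(p, q)) :
  grows k F -> grows k (fun X => (F X)^T).
Proof. by move=> [c hc]; exists c => X i j; rewrite mxE. Qed.

Lemma grows_mul k k' p q s (F : MX -> 'M[R]_(p, q)) (G : MX -> 'M[R]_(q, s)) :
  grows k F -> grows k' G -> grows (k + k') (fun X => F X *m G X).
Proof.
move=> [c hc] [c' hc']; exists (q%:R * (c * c')) => X i j; rewrite mxE.
apply: le_trans (ler_norm_sum _ _ _) _.
rewrite -[q in leRHS]card_ord -sumr_const !mulr_suml; apply: ler_sum => m _.
by rewrite normrM mul1r exprD mulrACA ler_pM.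
Qed.

Lemma grows_frob p q (F : MX -> 'M[R]_(p, q)) c :
  (forall X, frob (F X) <= c) -> grows 0 F.
Proof.
move=> hF; exists (Num.sqrt c) => X i j; rewrite expr0 mulr1 -sqrtr_sqr.
by rewrite ler_wsqrtr// (le_trans (sqr_entry_le_frob _ _ _)).
Qed.

End growth.

(** * The divergence identity for a Gaussian matrix *)

Section stein_mx.
Context d (T : measurableType d) (R : realType) (P : probability T R) (n l : nat).
Context (Omega : 'I_n * 'I_l -> {RV P >-> R}).
Hypothesis gaussOmega : standard_gaussian Omega.
Local Notation MX := 'M[R]_(n, l).
Local Notation Om w := (sample_mx Omega w).

Let mx_of (v : 'I_n * 'I_l -> R) : MX := \matrix_(i, j) v (i, j).

Let frob_mx_of v : frob (mx_of v) = \sum_ab v ab ^+ 2.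
Proof.
rewrite frobE exchange_big/= pair_bigA/=; apply: eq_bigr => -[a b] _.
by rewrite mxE.
Qed.

Let mx_of_upd v a b (x : R) :
  mx_of (upd v (a, b) x) = mx_of (upd v (a, b) 0) + x *: delta_mx a b.
Proof.
apply/matrixP => i j; rewrite !mxE /upd xpair_eqE.
by case: (i == a); case: (j == b); rewrite /= ?mulr1 ?mulr0 ?add0r ?addr0.
Qed.

Variables (F : MX -> MX) (DF : MX -> MX -> MX).
Hypothesis F_rat : rational_map F.
Hypothesis DF_rat : forall E, rational_map (DF ^~ E).
Hypothesis F_deriv : forall X E t,
  mderiv (fun s => F (X + s *: E)) t (DF (X + t *: E) E).
Hypothesis F_grows : grows 1 F.
Hypothesis DF_grows : forall E, grows 2 (DF ^~ E).

Definition divergence (X : MX) : R := \sum_a \sum_b DF X (delta_mx a b) a b.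

Let h a b (v : 'I_n * 'I_l -> R) : R :=
  DF (mx_of v) (delta_mx a b) a b - v (a, b) * F (mx_of v) a b.

Let mx_of_meas d' (S : measurableType d') (v : S -> 'I_n * 'I_l -> R) :
  (forall i, measurable_fun setT (fun s => v s i)) ->
  entrywise (fun f : S -> R => measurable_fun setT f) (fun s => mx_of (v s)).
Proof. by move=> mv i j; under eq_fun do rewrite mxE; exact: mv. Qed.

Let borel_h a b : borel_fun (h a b).
Proof.
move=> d' S v mv; have mc := measurable_alg_class (R := R) S.
apply: measurable_funB; first exact: (DF_rat (delta_mx a b) mc (mx_of_meas mv) a b).
by apply: measurable_funM => //; exact: (F_rat mc (mx_of_meas mv) a b).
Qed.

Let growF a b : quad_growth (fun v => v (a, b) * F (mx_of v) a b).
Proof.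
have [c hc] := F_grows; exists c => v.
rewrite -frob_mx_of -mxsize_sqr normrM mulrC expr2 mulrA.
apply: ler_pM => //.
by have := entry_le_mxsize (mx_of v) a b; rewrite mxE.
Qed.

Let grow_h a b : quad_growth (h a b).
Proof.
have [c hc] := growF a b; have [c' hc'] := DF_grows (delta_mx a b).
exists (c' + c) => v; rewrite mulrDl; apply: le_trans (ler_normB _ _) _.
apply: lerD; last exact: hc.
by rewrite -frob_mx_of -mxsize_sqr; exact: hc'.
Qed.

(** The entry [(a, b)] of the field is integrated by parts in the coordinate [(a, b)], and the
    results are summed. Linear growth of [F] keeps the product with a coordinate within quadratic
    growth. *)
Lemma integral_divergence :
  P.-integrable setT (fun w =>
    (divergence (Om w) - \sum_a \sum_b Om w a b * F (Om w) a b)%:E) /\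
  (\int[P]_w (divergence (Om w) - \sum_a \sum_b Om w a b * F (Om w) a b)%:E = 0)%E.
Proof.
have [indO lawO] := gaussOmega.
have E w : (divergence (Om w) - \sum_a \sum_b Om w a b * F (Om w) a b)%:E =
    (\sum_a \sum_b (h a b (fun ij => Omega ij w))%:E)%E.
  under [RHS]eq_bigr do rewrite sumEFin; rewrite sumEFin; congr _%:E.
  rewrite -sumrB; apply: eq_bigr => a _; rewrite -sumrB; apply: eq_bigr => b _.
  by rewrite /h mxE.
have ih a b : P.-integrable setT (fun w => (h a b (fun ij => Omega ij w))%:E).
  by apply: integrable_quad_growth.
under eq_fun do rewrite E.
split.
  by apply: integrable_sum => // a _; exact: integrable_sum.
rewrite integral_sum//; last by move=> a; exact: integrable_sum.
apply: big1 => a _; rewrite integral_sum//; apply: big1 => b _.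
apply: (stein indO lawO (a := (a, b)) (f := fun v => F (mx_of v) a b)) => //.
- move=> v x.
  have -> : h a b (upd v (a, b) x) + x * F (mx_of (upd v (a, b) x)) a b =
      DF (mx_of (upd v (a, b) x)) (delta_mx a b) a b.
    by rewrite /h {2}/upd eqxx subrK.
  rewrite mx_of_upd; under eq_fun do rewrite mx_of_upd.
  exact: F_deriv.
- move=> v; apply: derivable_all_continuous.
  have aff : entrywise derivable_all (fun x => mx_of (upd v (a, b) x)).
    move=> i j; under eq_fun do rewrite mx_of_upd mxE [X in _ + X]mxE.
    apply: derivable_all_add; first exact: derivable_all_cst.
    apply: derivable_all_mul; last exact: derivable_all_cst.
    by move=> t; exact: derivable_id.
  rewrite /h; apply: derivable_all_add.
    exact: (DF_rat (delta_mx a b) derivable_alg_class aff a b).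
  under eq_fun do rewrite {1}/upd eqxx -mulN1r.
  apply: derivable_all_mul; first exact: derivable_all_cst.
  apply: derivable_all_mul; first by move=> t; exact: derivable_id.
  exact: (F_rat derivable_alg_class aff a b).
Qed.

End stein_mx.

(** * Traces of linear maps on a space of matrices *)

Section delta_traces.
Context {R : realType}.

Lemma mul_delta_entry p q n l (A : 'M[R]_(p, n)) (B : 'M[R]_(l, q)) a b i j :
  (A *m delta_mx a b *m B) i j = A i a * B b j.
Proof.
rewrite -mulmxA mxE (bigD1 a)//= big1 ?addr0 => [|k ka].
  congr (_ * _); rewrite mxE (bigD1 b)//= big1 ?addr0 => [|k kb].
    by rewrite mxE !eqxx mul1r.
  by rewrite mxE (negbTE kb) andbF mul0r.
rewrite [(_ *m _) _ _]mxE big1 ?mulr0// => m _.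
by rewrite mxE (negbTE ka) mul0r.
Qed.

(** For linear [L] this is the trace of [L] as an endomorphism of the space of matrices; the
    divergence of a field is this trace of its derivative. *)
Definition entry_sum n l (L : 'M[R]_(n, l) -> 'M[R]_(n, l)) : R :=
  \sum_a \sum_b L (delta_mx a b) a b.

Lemma eq_entry_sum n l (L1 L2 : 'M[R]_(n, l) -> 'M[R]_(n, l)) :
  (forall E, L1 E = L2 E) -> entry_sum L1 = entry_sum L2.
Proof. by move=> /funext ->. Qed.

Lemma entry_sumD n l (L1 L2 : 'M[R]_(n, l) -> 'M[R]_(n, l)) :
  entry_sum (fun E => L1 E + L2 E) = entry_sum L1 + entry_sum L2.
Proof.
rewrite -big_split; apply: eq_bigr => a _; rewrite -big_split.
by apply: eq_bigr => b _; rewrite mxE.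
Qed.

Lemma entry_sumN n l (L : 'M[R]_(n, l) -> 'M[R]_(n, l)) :
  entry_sum (fun E => - L E) = - entry_sum L.
Proof.
rewrite -sumrN; apply: eq_bigr => a _; rewrite -sumrN.
by apply: eq_bigr => b _; rewrite mxE.
Qed.

Lemma sum_delta n l (A : 'M[R]_n) (B : 'M[R]_l) :
  entry_sum (fun E => A *m E *m B) = \tr A * \tr B.
Proof.
rewrite /entry_sum /mxtrace mulr_suml; apply: eq_bigr => a _; rewrite mulr_sumr.
by apply: eq_bigr => b _; rewrite mul_delta_entry.
Qed.

Lemma sum_delta_tr n l (A B : 'M[R]_(n, l)) :
  entry_sum (fun E => A *m E^T *m B) = \tr (A^T *m B).
Proof.
rewrite /entry_sum exchange_big; apply: eq_bigr => b _; rewrite mxE.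
apply: eq_bigr => a _. by rewrite trmx_delta mul_delta_entry mxE.
Qed.

Lemma sum_entries n l (A B : 'M[R]_(n, l)) :
  \sum_a \sum_b A a b * B a b = \tr (A^T *m B).
Proof.
rewrite exchange_big; apply: eq_bigr => b _; rewrite mxE; apply: eq_bigr => a _.
by rewrite mxE.
Qed.

End delta_traces.

(** * The two matrix fields and their divergences *)

Section gaussian_fields.
Context {R : realType} (n r l : nat) (V : 'M[R]_(n, r)) (eps : R).
Hypothesis eps_gt0 : 0 < eps.
Hypothesis V_orth : V^T *m V = 1%:M.
Local Notation MX := 'M[R]_(n, l).
Implicit Types (X E : MX).

Local Notation K X := (resolvent eps (V^T *m X)).
Local Notation W X := (ridge eps (V^T *m X)).
Local Notation Q X := (hat_mx eps (V^T *m X)).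
Local Notation S X := (ridge_gram eps (V^T *m X)).
Local Notation DW X E := (dridge eps (V^T *m X) (V^T *m E)).

Let rZ : rational_map (fun X : MX => V^T *m X).
Proof. by apply: rational_mul; [exact: rational_cst|exact: rational_id]. Qed.

Lemma rational_resolvent : rational_map (fun X : MX => K X).
Proof.
apply: rational_inv; first by move=> X; exact: reg_gram_unit.
apply: rational_add; last exact: rational_cst.
by apply: rational_mul => //; exact: rational_tr.
Qed.

Lemma rational_ridge : rational_map (fun X : MX => W X).
Proof. by apply: rational_mul => //; exact: rational_resolvent. Qed.

Lemma rational_ridge_gram : rational_map (fun X : MX => S X).
Proof.
by apply: rational_mul; [apply: rational_tr|]; exact: rational_ridge.
Qed.

Lemma rational_dridge E : rational_map (fun X : MX => DW X E).
Proof.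
apply: rational_add; last apply: rational_opp.
  apply: rational_mul.
    by apply: rational_mul; [exact: rational_resolvent|exact: rational_cst].
  apply: rational_add; first exact: rational_cst.
  apply: rational_opp; apply: rational_mul; last exact: rational_ridge.
  exact: rational_tr.
apply: rational_mul; last exact: rational_ridge.
by apply: rational_mul; [exact: rational_ridge|exact: rational_cst].
Qed.

Lemma grows_resolvent : grows 0 (fun X : MX => K X).
Proof.
apply: (grows_frob (c := r%:R / eps / eps)) => X.
rewrite ler_pdivlMr// mulrC; apply: le_trans (frob_resolvent_le eps_gt0 _) _.
exact: tr_resolvent_le.
Qed.

Lemma grows_ridge : grows 0 (fun X : MX => W X).
Proof.
apply: (grows_frob (c := r%:R / eps)) => X.
by apply: le_trans (frob_ridge_le eps_gt0 _) _; exact: tr_resolvent_le.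
Qed.

Lemma grows_hat_mx : grows 0 (fun X : MX => Q X).
Proof. by apply: (grows_frob (c := r%:R)) => X; exact: frob_hat_mx_le. Qed.

Lemma grows_ridge_gram : grows 0 (fun X : MX => S X).
Proof. exact: (grows_mul (grows_tr grows_ridge) grows_ridge). Qed.

Lemma grows_dridge E : grows 0 (fun X : MX => DW X E).
Proof.
have g1 := grows_mul grows_resolvent (grows_cst n l (V^T *m E)).
have g2 := grows_add (grows_cst n l 1%:M) (grows_opp grows_hat_mx).
have g3 := grows_mul grows_ridge (grows_cst n l (V^T *m E)^T).
exact: (grows_add (grows_mul g1 g2) (grows_opp (grows_mul g3 grows_ridge))).
Qed.

Lemma mderiv_line (X E : MX) t : mderiv (fun s : R => X + s *: E) t E.
Proof.
move=> i j; under eq_fun do rewrite !mxE.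
apply: is_derive_eq; rewrite /GRing.scale/=; lra.
Qed.

Lemma mderiv_ridge_line (X E : MX) t :
  mderiv (fun s => W (X + s *: E)) t (DW (X + t *: E) E).
Proof.
apply: (mderiv_ridge eps_gt0 (Z := fun s => V^T *m (X + s *: E))).
  apply: (rZ derivable_alg_class) => i j.
  under eq_fun do rewrite !mxE.
  apply: derivable_all_add; first exact: derivable_all_cst.
  apply: derivable_all_mul; last exact: derivable_all_cst.
  by move=> s; exact: derivable_id.
have := mderiv_mul (mderiv_cst V^T t) (mderiv_line X E t).
by rewrite mul0mx add0r.
Qed.

Definition ridge_field (X : MX) : MX := V *m W X.
Definition dridge_field (X E : MX) : MX := V *m DW X E.

Lemma ridge_field_deriv X E t :
  mderiv (fun s => ridge_field (X + s *: E)) t (dridge_field (X + t *: E) E).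
Proof.
have := mderiv_mul (mderiv_cst V t) (mderiv_ridge_line X E t).
by rewrite mul0mx add0r.
Qed.

Lemma dridge_fieldE X E : dridge_field X E =
  V *m K X *m V^T *m E *m (1%:M - Q X) - V *m W X *m E^T *m (V *m W X).
Proof. by rewrite /dridge_field /dridge mulmxBr trmx_mul trmxK !mulmxA. Qed.

Lemma frob_isometry (A : 'M[R]_(r, l)) : frob (V *m A) = frob A.
Proof. by rewrite /frob trmx_mul mulmxA -(mulmxA _ V^T) V_orth mulmx1. Qed.

(** The part of the derivative with [E^T] costs only [frob (W X)], which is at most [\tr (K X)]:
    this is the -1 in [l - r - 1]. *)
Lemma divergence_ridge_field X : divergence dridge_field X =
  \tr (K X) * (l%:R - \tr (Q X)) - frob (W X).
Proof.
rewrite -[LHS]/(entry_sum (dridge_field X)).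
rewrite (eq_entry_sum (dridge_fieldE X)).
rewrite entry_sumD entry_sumN sum_delta sum_delta_tr -[\tr (_^T *m _)]/(frob _) frob_isometry.
by rewrite mxtrace_mulC mulmxA V_orth mul1mx raddfB/= mxtrace1.
Qed.

Lemma pairing_ridge_field X :
  \sum_a \sum_b X a b * ridge_field X a b = \tr (Q X).
Proof.
by rewrite sum_entries /ridge_field mulmxA /hat_mx trmx_mul trmxK.
Qed.

Variable v : 'cV[R]_n.
Hypothesis v_unit : v^T *m v = 1%:M.
Hypothesis v_orth : V^T *m v = 0.

Let vV : v^T *m V = 0.
Proof. by rewrite -[V]trmxK -trmx_mul v_orth trmx0. Qed.

Definition quad_field (X : MX) : MX := v *m v^T *m X *m S X.
Definition dquad_field (X E : MX) : MX :=
  v *m v^T *m E *m S X +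
  v *m v^T *m X *m ((DW X E)^T *m W X + (W X)^T *m DW X E).

Lemma quad_field_deriv X E t :
  mderiv (fun s => quad_field (X + s *: E)) t (dquad_field (X + t *: E) E).
Proof.
have dW := mderiv_ridge_line X E t.
have := mderiv_mul (mderiv_mul (mderiv_cst (v *m v^T) t) (mderiv_line X E t))
  (mderiv_mul (mderiv_tr dW) dW).
by rewrite mul0mx add0r.
Qed.

(** Each summand is brought to the form [A E B] or [A E^T B], whose sum over matrix units is a
    product of traces or a single trace. *)
Lemma dquad_fieldE X E : dquad_field X E =
  v *m v^T *m E *m S X
  + (v *m v^T *m X *m (1%:M - Q X) *m E^T *m (V *m K X *m W X)
     - v *m v^T *m X *m (W X)^T *m V^T *m E *m ((W X)^T *m W X)
     + (v *m v^T *m X *m (W X)^T *m K X *m V^T *m E *m (1%:M - Q X)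
        - v *m v^T *m X *m (W X)^T *m W X *m E^T *m (V *m W X))).
Proof.
rewrite /dquad_field /dridge; congr (_ + _).
set A := v *m v^T *m X; set K := resolvent _ _; set W := ridge _ _; set Q := hat_mx _ _.
have KT : K^T = K by exact: resolvent_tr.
have QT : (1%:M - Q)^T = 1%:M - Q by rewrite linearB/= trmx1 hat_mx_tr.
move: K W Q KT QT => K W Q KT QT.
have -> : (K *m (V^T *m E) *m (1%:M - Q) - W *m (V^T *m E)^T *m W)^T *m W =
   (1%:M - Q) *m E^T *m (V *m K *m W) - W^T *m V^T *m E *m (W^T *m W).
  rewrite linearB/= mulmxBl [(_ *m (1%:M - Q))^T]trmx_mul QT.
  by rewrite !trmx_mul !trmxK KT !mulmxA.
have -> : W^T *m (K *m (V^T *m E) *m (1%:M - Q) - W *m (V^T *m E)^T *m W) =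
   W^T *m K *m V^T *m E *m (1%:M - Q) - W^T *m W *m E^T *m (V *m W).
  by rewrite mulmxBr trmx_mul trmxK !mulmxA.
by rewrite mulmxDr [X in X + _]mulmxBr [X in _ + X]mulmxBr !mulmxA.
Qed.

(** Only the first of the five summands survives, as [v v^T] has trace 1. Each of the others
    contains [V^T v] or [v^T V] under a trace, and both products vanish. *)
Lemma divergence_quad_field X : divergence dquad_field X = \tr (S X).
Proof.
rewrite -[LHS]/(entry_sum (dquad_field X)).
rewrite (eq_entry_sum (dquad_fieldE X)).
rewrite !(entry_sumD, entry_sumN, sum_delta, sum_delta_tr).
have -> : \tr (v *m v^T) = 1 by rewrite mxtrace_mulC v_unit mxtrace1.
move: (S X) (K X) (W X) (Q X) => s k w q.
rewrite [\tr (v *m v^T *m X *m w^T *m V^T)]mxtrace_mulC.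
rewrite [\tr (v *m v^T *m X *m w^T *m k *m V^T)]mxtrace_mulC.
rewrite !mulmxA v_orth !mul0mx mxtrace0 !mul0r.
have z1 (A : 'M[R]_l) (B : 'M[R]_(r, l)) :
    \tr ((v *m v^T *m X *m A)^T *m V *m B) = 0.
  by rewrite !trmx_mul !trmxK !mulmxA -(mulmxA _ v^T V) vV mulmx0 mul0mx mxtrace0.
rewrite -(mulmxA _ k w) z1 -(mulmxA _ w^T w) z1.
by rewrite mul1r !subr0 !addr0.
Qed.

Lemma pairing_quad_field X :
  \sum_a \sum_b X a b * quad_field X a b = \tr (X^T *m v *m (v^T *m X) *m S X).
Proof. by rewrite sum_entries /quad_field !mulmxA. Qed.

Lemma rational_ridge_field : rational_map ridge_field.
Proof. by apply: rational_mul; [exact: rational_cst|exact: rational_ridge]. Qed.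

Lemma rational_dridge_field E : rational_map (dridge_field ^~ E).
Proof. by apply: rational_mul; [exact: rational_cst|exact: rational_dridge]. Qed.

Lemma rational_quad_field : rational_map quad_field.
Proof.
apply: rational_mul; last exact: rational_ridge_gram.
by apply: rational_mul; [exact: rational_cst|exact: rational_id].
Qed.

Lemma rational_dquad_field E : rational_map (dquad_field ^~ E).
Proof.
apply: rational_add.
  by apply: rational_mul; [exact: rational_cst|exact: rational_ridge_gram].
apply: rational_mul.
  by apply: rational_mul; [exact: rational_cst|exact: rational_id].
apply: rational_add; apply: rational_mul; try exact: rational_ridge.
- by apply: rational_tr; exact: rational_dridge.
- by apply: rational_tr; exact: rational_ridge.
- exact: rational_dridge.
Qed.

Lemma grows_ridge_field : grows 0 ridge_field.
Proof. exact: (grows_mul (grows_cst n l V) grows_ridge). Qed.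

Lemma grows_dridge_field E : grows 0 (dridge_field ^~ E).
Proof. exact: (grows_mul (grows_cst n l V) (grows_dridge E)). Qed.

Lemma grows_quad_field : grows 1 quad_field.
Proof.
exact: (grows_mul (grows_mul (grows_cst n l (v *m v^T)) (@grows_id R n l))
  grows_ridge_gram).
Qed.

Lemma grows_dquad_field E : grows 1 (dquad_field ^~ E).
Proof.
have g1 := grows_mul (grows_cst n l (v *m v^T *m E)) grows_ridge_gram.
have g2 := grows_mul (grows_tr (grows_dridge E)) grows_ridge.
have g3 := grows_mul (grows_tr grows_ridge) (grows_dridge E).
have g4 := grows_mul (grows_mul (grows_cst n l (v *m v^T)) (@grows_id R n l))
  (grows_add g2 g3).
exact: (grows_add (growsW (leq0n 1) g1) g4).
Qed.

End gaussian_fields.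

(** * Expectations of the resolvent and of the quadratic terms *)

Section gaussian_expectations.
Context d (T : measurableType d) (R : realType) (P : probability T R) (n r l : nat).
Context (Omega : 'I_n * 'I_l -> {RV P >-> R}).
Hypothesis gaussOmega : standard_gaussian Omega.
Context (V : 'M[R]_(n, r)) (eps : R).
Hypothesis eps_gt0 : 0 < eps.
Hypothesis V_orth : V^T *m V = 1%:M.
Local Notation Om w := (sample_mx Omega w).
Local Notation K w := (resolvent eps (V^T *m Om w)).
Local Notation S w := (ridge_gram eps (V^T *m Om w)).

Lemma entrywise_sample_mx :
  entrywise (fun f : T -> R => measurable_fun setT f) (fun w => Om w).
Proof. by move=> i j; under eq_fun do rewrite mxE; exact: measurable_funPT. Qed.

Lemma measurable_tr_rational p (F : 'M[R]_(n, l) -> 'M[R]_p) : rational_map F ->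
  measurable_fun setT (fun w => \tr (F (Om w))).
Proof.
move=> rF; have mc := measurable_alg_class (R := R) T.
have := rF _ _ mc _ entrywise_sample_mx.
by have [h1 h2 _ _] := mc; exact: closed_trace.
Qed.

Lemma integrable_bounded (f : T -> R) c : measurable_fun setT f ->
  (forall w, `|f w| <= c) -> P.-integrable setT (fun w => (f w)%:E).
Proof.
move=> mf fc.
have ic : P.-integrable setT (fun=> c%:E) by exact: finite_measure_integrable_cst.
apply: le_integrable ic => //; first exact/measurable_EFinP.
by move=> w _; rewrite lee_fin (le_trans (fc w))// ler_norm.
Qed.

Lemma integrable_tr_resolvent : P.-integrable setT (fun w => (\tr (K w))%:E).
Proof.
apply: (@integrable_bounded _ (r%:R / eps)).
  apply: (measurable_tr_rational (F := fun X => resolvent eps (V^T *m X))).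
  exact: rational_resolvent.
move=> w; rewrite ger0_norm ?tr_resolvent_ge0//; exact: tr_resolvent_le.
Qed.

Lemma integrable_tr_ridge_gram : P.-integrable setT (fun w => (\tr (S w))%:E).
Proof.
apply: (@integrable_bounded _ (r%:R / eps)).
  apply: (measurable_tr_rational (F := fun X => ridge_gram eps (V^T *m X))).
  exact: rational_ridge_gram.
move=> w; rewrite ger0_norm ?frob_ge0//.
by apply: le_trans (tr_ridge_gram_le eps_gt0 _) _; exact: tr_resolvent_le.
Qed.

(* The inverse Wishart trace bound: [p - 1] is [l - r - 1] for [l = r + p]. *)
Lemma expected_tr_resolvent : (r.+1 < l)%N ->
  (\int[P]_w (\tr (K w))%:E <= (r%:R / (l%:R - r%:R - 1))%:E)%E.
Proof.
move=> rl.
have c0 : 0 < l%:R - r%:R - 1 :> R.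
  by rewrite -addrA -opprD natr1 subr_gt0 ltr_nat.
have [ih h0] := integral_divergence gaussOmega (F := ridge_field V eps)
  (DF := dridge_field V eps) (rational_ridge_field V eps_gt0)
  (rational_dridge_field V eps_gt0) (ridge_field_deriv V eps_gt0)
  (growsW (leq0n 1) (grows_ridge_field l V eps_gt0))
  (fun E => growsW (leq0n 2) (grows_dridge_field V eps_gt0 E)).
set c := _ - 1 in c0 *.
have iK := integrable_tr_resolvent.
have le1 : (\int[P]_w (c%:E * (\tr (K w))%:E - r%:R%:E) <= 0)%E.
  rewrite -h0; apply: le_integral => //.
    apply: integrableB => //; first exact: integrableZl.
    exact: finite_measure_integrable_cst.
  move=> w _; rewrite -EFinM -EFinB lee_fin.
  rewrite (divergence_ridge_field eps V_orth) pairing_ridge_field.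
  set X := V^T *m _.
  (* [\tr Q <= r] and [frob W <= \tr K] bound the integrand below by [c * \tr K - r]. *)
  have := frob_ridge_le eps_gt0 X; have := tr_hat_mx_le eps_gt0 X.
  have := tr_resolvent_ge0 eps_gt0 X; rewrite /c; nra.
move: le1; rewrite integralB//; last 2 first.
  exact: integrableZl.
  exact: finite_measure_integrable_cst.
rewrite integralZl// integral_cst//.
rewrite [X in (_ - _ * X)%E](@probability_setT _ _ _ P) mule1 sube_le0 => h1.
by rewrite EFinM muleC lee_pdivlMl.
Qed.

(** The integrand of the divergence identity is [\tr (S w)] minus the quadratic term; since
    [\tr (S w)] is bounded, integrability of the quadratic term comes with the identity. *)
Lemma integrable_quad (v : 'cV[R]_n) : v^T *m v = 1%:M -> V^T *m v = 0 ->
  P.-integrable setT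
    (fun w => (\tr ((Om w)^T *m v *m (v^T *m Om w) *m S w))%:E) /\
  (\int[P]_w (\tr ((Om w)^T *m v *m (v^T *m Om w) *m S w))%:E <=
   \int[P]_w (\tr (K w))%:E)%E.
Proof.
move=> v1 v0.
have [] := integral_divergence gaussOmega (F := quad_field V eps v)
  (DF := dquad_field V eps v) (rational_quad_field V eps_gt0 v)
  (rational_dquad_field V eps_gt0 v) (quad_field_deriv V eps_gt0 v)
  (grows_quad_field l V eps_gt0 v)
  (fun E => growsW (isT : (1 <= 2)%N) (grows_dquad_field V eps_gt0 v E)).
pose q w := \tr ((Om w)^T *m v *m (v^T *m Om w) *m S w).
have hE w : divergence (dquad_field V eps v) (Om w) -
    \sum_a \sum_b Om w a b * quad_field V eps v (Om w) a b = \tr (S w) - q w.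
  by rewrite divergence_quad_field// pairing_quad_field.
rewrite (_ : (fun w => (divergence _ _ - _)%:E) =
  (fun w => (\tr (S w) - q w)%:E)); last by apply/funext => w; rewrite hE.
move=> ih h0.
have iS := integrable_tr_ridge_gram.
have iq : P.-integrable setT (fun w => (q w)%:E).
  have := integrableB measurableT iS ih; apply: eq_integrable => // w _.
  by rewrite /= -EFinB opprB addrC subrK.
split=> //; have : (\int[P]_w (\tr (S w))%:E - \int[P]_w (q w)%:E = 0)%E.
  by rewrite -h0 -integralB//; apply: eq_integral => w _; rewrite EFinB.
move=> h1; have : (0 <= \int[P]_w (\tr (S w))%:E - \int[P]_w (q w)%:E)%E by rewrite h1.
rewrite suber_ge0; last exact: integrable_fin_num.
move/le_trans; apply; apply: le_integral => // [|w _].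
  exact: integrable_tr_resolvent.
by rewrite lee_fin tr_ridge_gram_le.
Qed.

End gaussian_expectations.

(** * Orthogonal projectors and Ky Fan's inequality *)

Section weighted_sums.
Context {R : realType}.
Implicit Types mu : nat -> R.

Lemma ler_weighted_sum mu N k (c : 'I_N -> R) :
  (forall i, 0 <= mu i) -> (forall i j, (i <= j)%N -> mu j <= mu i) ->
  (forall i, 0 <= c i <= 1) -> \sum_i c i <= k%:R ->
  \sum_(i < N) mu i * c i <= \sum_(i < k) mu i.
Proof.
move=> mu0 mu_dec c01 ck.
have -> : \sum_(i < N) mu i * c i =
    \sum_(i < N) (mu i - mu k) * c i + mu k * \sum_i c i.
  by rewrite mulr_sumr -big_split; apply: eq_bigr => i _ /=; ring.
have -> : \sum_(i < k) mu i = \sum_(i < k) (mu i - mu k) + mu k * k%:R.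
  by rewrite sumrB sumr_const card_ord -[mu k *+ _]mulr_natr subrK.
apply: lerD; last by rewrite ler_wpM2l.
apply: (@le_trans _ _ (\sum_(i < N | (i < k)%N) (mu i - mu k))).
  rewrite [leRHS]big_mkcond/=; apply: ler_sum => i _.
  have /andP[c0 c1] := c01 i; case: ltnP => ik.
    by rewrite ler_piMr// subr_ge0 mu_dec// ltnW.
  by rewrite mulr_le0_ge0// subr_le0 mu_dec.
pose F i := mu i - mu k.
(* Either of [N] and [k] may be the larger, so both sums are extended to [maxn N k]. *)
rewrite (big_ord_widen_cond (maxn N k) (fun i => (i < k)%N) F (leq_maxl N k)).
rewrite (big_ord_widen (maxn N k) F (leq_maxr N k)).
rewrite [leLHS]big_mkcond [leRHS]big_mkcond; apply: ler_sum => i _.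
case: (i < N)%N; case: ltnP => //= ik; last by rewrite subr_ge0 mu_dec// ltnW.
Qed.

Lemma lamE k (s : 'rV[R]_k) (i : 'I_k) : lam s i = s 0 i ^+ 2.
Proof. by rewrite /lam valK. Qed.

Lemma lam_ge0 k (s : 'rV[R]_k) i : 0 <= lam s i.
Proof. by rewrite /lam; case: insub => [j|]//=; exact: sqr_ge0. Qed.

End weighted_sums.

Section projectors.
Context {R : realType}.

Definition projector n (Pi : 'M[R]_n) : Prop := Pi^T = Pi /\ Pi *m Pi = Pi.

Lemma projector_compl n (Pi : 'M[R]_n) : projector Pi -> projector (1%:M - Pi).
Proof.
move=> [PT PP]; split; first by rewrite linearB/= trmx1 PT.
by rewrite mulmxBl mul1mx mulmxBr mulmx1 PP subrr subr0.
Qed.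

Lemma projector_range n k (V : 'M[R]_(n, k)) : V^T *m V = 1%:M -> projector (V *m V^T).
Proof.
by move=> VV; split; rewrite ?trmx_mul ?trmxK// mulmxA -(mulmxA _ V^T) VV mulmx1.
Qed.

Lemma frob_projector n k (Pi : 'M[R]_n) (M : 'M[R]_(n, k)) : projector Pi ->
  frob (Pi *m M) = \tr (M^T *m Pi *m M).
Proof. by move=> [PT PP]; rewrite /frob trmx_mul PT !mulmxA -(mulmxA _ Pi Pi) PP. Qed.

Lemma frob_projector_split n k (Pi : 'M[R]_n) (M : 'M[R]_(n, k)) : projector Pi ->
  frob M = frob (Pi *m M) + frob ((1%:M - Pi) *m M).
Proof.
move=> pP; rewrite !frob_projector//; last exact: projector_compl.
by rewrite mulmxBr mulmx1 mulmxBl linearB/= addrC subrK.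
Qed.

Lemma frob_projector_le n k (Pi : 'M[R]_n) (M : 'M[R]_(n, k)) : projector Pi ->
  frob (Pi *m M) <= frob M.
Proof. by move=> pP; rewrite (frob_projector_split M pP) lerDl frob_ge0. Qed.

Lemma gram_diag n k (M : 'M[R]_(n, k)) i : (M^T *m M) i i = \sum_j M j i ^+ 2.
Proof. by rewrite mxE; apply: eq_bigr => j _; rewrite mxE expr2. Qed.

Section projected_basis.
Context n k (Pi : 'M[R]_n) (V : 'M[R]_(n, k)).
Hypothesis pP : projector Pi.
Hypothesis VV : V^T *m V = 1%:M.

Lemma projected_basis_weight i : 0 <= (V^T *m Pi *m V) i i <= 1.
Proof.
have gram Q : projector Q -> 0 <= (V^T *m Q *m V) i i.
  move=> [QT QQ]; have -> : V^T *m Q *m V = (Q *m V)^T *m (Q *m V).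
    by rewrite trmx_mul QT !mulmxA -(mulmxA _ Q Q) QQ.
  by rewrite gram_diag sumr_ge0// => j _; exact: sqr_ge0.
rewrite gram//=; have := gram _ (projector_compl pP).
by rewrite mulmxBr mulmx1 mulmxBl VV [X in 0 <= X]mxE [X in X + _]mxE eqxx mxE subr_ge0.
Qed.

(** [\tr (V^T Pi V) = |V V^T Pi|^2 <= |Pi|^2 = \tr Pi], since [V V^T] and [Pi] are projectors. *)
Lemma sum_projected_basis_weight : \tr (V^T *m Pi *m V) <= \tr Pi.
Proof.
have := frob_projector_le Pi (projector_range VV).
have [PT PP] := pP; rewrite {2}/frob PT PP; apply: le_trans.
rewrite (frob_projector _ (projector_range VV)) PT.
rewrite [leRHS]mxtrace_mulC !mulmxA PP -!mulmxA [leRHS]mxtrace_mulC -!mulmxA.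
by rewrite [leRHS]mxtrace_mulC -!mulmxA.
Qed.

(** The trace equals [\sum_i lam s i * c i], where the [c i = (V^T Pi V) i i] lie between 0 and 1
    and sum to at most [\tr Pi]. *)
Lemma ky_fan_le (s : 'rV[R]_k) q : (forall i, 0 <= s 0 i) ->
  (forall i j : 'I_k, (i <= j)%N -> s 0 j <= s 0 i) -> \tr Pi <= q%:R ->
  \tr (Pi *m (V *m diag_mx (\row_i s 0 i ^+ 2) *m V^T)) <= \sum_(i < q) lam s i.
Proof.
move=> s0 sdec trPi.
have lam_dec i j : (i <= j)%N -> lam s j <= lam s i.
  move=> ij; have [jk|kj] := ltnP j k; last first.
    by rewrite {1}/lam insubF ?lam_ge0// ltnNge kj.
  rewrite (lamE s (Ordinal jk)) (lamE s (Ordinal (leq_ltn_trans ij jk))).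
  by rewrite ler_sqr ?nnegrE// sdec.
have := ler_weighted_sum (lam_ge0 s) lam_dec projected_basis_weight
  (le_trans sum_projected_basis_weight trPi).
apply: le_trans; rewrite le_eqVlt; apply/orP; left; apply/eqP.
rewrite mulmxA mxtrace_mulC !mulmxA mul_mx_diag.
by apply: eq_bigr => i _; rewrite mxE [X in _ * X]mxE lamE mulrC.
Qed.

End projected_basis.
End projectors.

Section frobenius_products.
Context {R : realType}.

Lemma frob_cV n (x : 'cV[R]_n) : x^T *m x = (frob x)%:M.
Proof. by rewrite [LHS]mx11_scalar /frob /mxtrace big_ord1. Qed.

Lemma line_projector n (x : 'cV[R]_n) : x != 0 ->
  projector ((frob x)^-1 *: (x *m x^T)).
Proof.
move=> x0; have fx : frob x != 0 by apply: contra x0 => /eqP/frob_eq0/eqP.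
split; first by rewrite linearZ/= trmx_mul trmxK.
rewrite -scalemxAl -scalemxAr mulmxA -(mulmxA x) frob_cV mul_mx_scalar -scalemxAl.
by rewrite !scalerA mulVf// mulr1.
Qed.

(** A form of the Cauchy-Schwarz inequality: [|M x|^2 / |x|^2] is the squared norm of [M^T]
    projected onto the line of [x]. *)
Lemma frob_mul_cV_le p n (M : 'M[R]_(p, n)) (x : 'cV[R]_n) :
  frob (M *m x) <= frob M * frob x.
Proof.
have [->|x0] := eqVneq x 0; first by rewrite mulmx0 /frob !mulmx0 mxtrace0 mulr0.
have fx : 0 < frob x.
  rewrite lt_neqAle frob_ge0 andbT eq_sym.
  by apply: contra x0 => /eqP/frob_eq0/eqP.
have := frob_projector_le M^T (line_projector x0).
rewrite frob_tr frob_projector ?trmxK; last exact: line_projector.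
rewrite -scalemxAr -scalemxAl mxtraceZ ler_pdivrMl// mulrC; apply: le_trans.
by rewrite -frob_tr /frob trmxK trmx_mul !mulmxA.
Qed.

End frobenius_products.

(** * The Nystrom approximation as a projection *)

Section nystrom.
Context {R : realType} (m n l : nat) (A : 'M[R]_(m, n)) (X : 'M[R]_(n, l)).
Variables (L Li : 'M[R]_l).
Hypothesis LLT : L *m L^T = (A *m X)^T *m (A *m X).
Hypothesis L_pinv : is_pinv L Li.

(** With [B = A X] this is [B (B^T B)^+ B^T], the orthogonal projector onto the range of [B],
    because [Li^T Li] is the pseudo-inverse of [L L^T = B^T B]. *)
Definition nys_proj : 'M[R]_m := A *m X *m Li^T *m Li *m (A *m X)^T.

Lemma nys_proj_projector : projector nys_proj.
Proof.
case: L_pinv => LLiL LiLLi LLi LiL; split.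
  by rewrite /nys_proj !trmx_mul !trmxK !mulmxA.
have e : Li *m (L *m L^T) *m Li^T = Li *m L.
  by rewrite !mulmxA -(mulmxA _ L^T) -trmx_mul LiL !mulmxA LiLLi.
rewrite /nys_proj; have := LLT; move: (A *m X) => B hB.
have -> : B *m Li^T *m Li *m B^T *m (B *m Li^T *m Li *m B^T) =
    B *m Li^T *m (Li *m (B^T *m B) *m Li^T) *m Li *m B^T by rewrite !mulmxA.
by rewrite -hB e -!mulmxA (mulmxA L Li) (mulmxA Li (L *m Li)) (mulmxA Li L) LiLLi.
Qed.

(** [|(1 - P) B|^2] is the trace of [C - C C^+ C] for [C = B^T B], hence 0. *)
Lemma nys_proj_sketch : nys_proj *m (A *m X) = A *m X.
Proof.
case: L_pinv => LLiL LiLLi LLi LiL.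
have pC := projector_compl nys_proj_projector.
apply/eqP; rewrite eq_sym -subr_eq0 -[X in X - _]mul1mx -mulmxBl.
apply/eqP/frob_eq0; rewrite frob_projector// /nys_proj.
have := LLT; move: (A *m X) => B hB.
rewrite mulmxBr mulmx1 mulmxBl.
have -> : B^T *m (B *m Li^T *m Li *m B^T) *m B =
    (B^T *m B) *m Li^T *m Li *m (B^T *m B) by rewrite !mulmxA.
have e : L *m L^T *m Li^T *m Li *m (L *m L^T) = L *m L^T.
  rewrite -(mulmxA L L^T) -trmx_mul LiL !mulmxA.
  by rewrite !LLiL.
by rewrite -hB e subrr mxtrace0.
Qed.

Lemma nys_gram : (Li *m (A^T *m A *m X)^T)^T *m (Li *m (A^T *m A *m X)^T) =
  A^T *m nys_proj *m A.
Proof. by rewrite /nys_proj !trmx_mul !trmxK !mulmxA. Qed.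

End nystrom.

Section svd_gram.
Context {R : realType}.

Definition sqr_row k (s : 'rV[R]_k) : 'rV[R]_k := \row_i s 0 i ^+ 2.

Lemma diag_sqr_row k (s : 'rV[R]_k) : diag_mx s *m diag_mx s = diag_mx (sqr_row s).
Proof. by rewrite mulmx_diag; congr diag_mx; apply/rowP => i; rewrite !mxE expr2. Qed.

Lemma svd_gram p n k (M : 'M[R]_(p, n)) (U : 'M[R]_(p, k)) s (V : 'M[R]_(n, k)) :
  U^T *m U = 1%:M -> M = U *m diag_mx s *m V^T ->
  M^T *m M = V *m diag_mx (sqr_row s) *m V^T.
Proof.
move=> UU ->; rewrite !trmx_mul trmxK tr_diag_mx -diag_sqr_row !mulmxA.
by rewrite -(mulmxA _ U^T U) UU mulmx1.
Qed.

Lemma lam_default k (s : 'rV[R]_k) i : (k <= i)%N -> lam s i = 0.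
Proof. by move=> ki; rewrite /lam insubF// ltnNge ki. Qed.

Lemma tr_conj_diag n k (V : 'M[R]_(n, k)) (e : 'rV[R]_k) : V^T *m V = 1%:M ->
  \tr (V *m diag_mx e *m V^T) = \sum_i e 0 i.
Proof. by move=> VV; rewrite mxtrace_mulC mulmxA VV mul1mx mxtrace_diag. Qed.

End svd_gram.

(** * The error of the truncated approximation *)

Section truncation.
Context {R : realType} (m n r q l : nat).
Variables (A : 'M[R]_(m, n)) (X : 'M[R]_(n, l)) (P : 'M[R]_m).
Variables (V : 'M[R]_(n, r)) (V' : 'M[R]_(n, q)) (s : 'rV[R]_r) (s' : 'rV[R]_q).
Hypothesis P_proj : projector P.
Hypothesis P_sketch : P *m (A *m X) = A *m X.
Hypothesis VV_orth : (row_mx V V')^T *m row_mx V V' = 1%:M.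
Hypothesis s_ge0 : forall i, 0 <= row_mx s s' 0 i.
Hypothesis s_dec : forall i j : 'I_(r + q), (i <= j)%N ->
  row_mx s s' 0 j <= row_mx s s' 0 i.
Hypothesis nys_svd : A^T *m P *m A =
  row_mx V V' *m diag_mx (sqr_row (row_mx s s')) *m (row_mx V V')^T.

Local Notation H := (A^T *m A).
Definition trunc_approx : 'M[R]_n := V *m diag_mx (sqr_row s) *m V^T.
Local Notation Hhat := trunc_approx.

Let orth : V^T *m V = 1%:M /\ V^T *m V' = 0.
Proof.
move: VV_orth; rewrite tr_row_mx mul_col_row scalar_mx_block.
by move=> /eq_block_mx h; case: h => -> -> _ _.
Qed.

Lemma trunc_split :
  A^T *m P *m A = Hhat + V' *m diag_mx (sqr_row s') *m V'^T.
Proof.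
have -> : A^T *m P *m A =
    row_mx V V' *m diag_mx (row_mx (sqr_row s) (sqr_row s')) *m (row_mx V V')^T.
  rewrite nys_svd; congr (_ *m diag_mx _ *m _); apply/rowP => i; rewrite !mxE.
  by case: (fintype.split i) => j; rewrite mxE.
by rewrite diag_mx_row mul_row_block !mulmx0 addr0 add0r tr_row_mx mul_row_col.
Qed.

(** [H - Hhat] is the untruncated error [A^T (1 - P) A] plus the discarded part [V' s'^2 V'^T];
    stacking a root of each gives a root of the sum. *)
Definition residual_root : 'M[R]_(m + q, n) :=
  col_mx ((1%:M - P) *m A) (diag_mx s' *m V'^T).

Lemma residual_gram : H - Hhat = residual_root^T *m residual_root.
Proof.
rewrite /residual_root tr_col_mx mul_row_col.
have [PT PP] := projector_compl P_proj.
have -> : ((1%:M - P) *m A)^T *m ((1%:M - P) *m A) = H - A^T *m P *m A.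
  rewrite trmx_mul PT !mulmxA -(mulmxA A^T (1%:M - P) (1%:M - P)) PP mulmxBr mulmx1.
  by rewrite mulmxBl.
rewrite trmx_mul trmxK tr_diag_mx mulmxA -(mulmxA V' (diag_mx s')) diag_sqr_row.
by rewrite trunc_split opprD addrA subrK.
Qed.

Lemma trace_trunc : \tr Hhat = \sum_(i < r) lam (row_mx s s') i.
Proof.
rewrite tr_conj_diag; last by case: orth.
apply: eq_bigr => i _; rewrite mxE -[nat_of_ord i]/(nat_of_ord (lshift q i)).
by rewrite lamE row_mxEl.
Qed.

Lemma trunc_ky_fan (Pi : 'M[R]_n) : projector Pi -> \tr Pi <= r%:R ->
  \tr (Pi *m (A^T *m P *m A)) <= \tr Hhat.
Proof.
by move=> pPi trPi; rewrite trace_trunc nys_svd; exact: ky_fan_le.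
Qed.

(* [M] is free: [A V1 - A X M] differs from [A V1] by a matrix in the range of [P]. *)
Lemma trace_residual_le (V1 : 'M[R]_(n, r)) (M : 'M[R]_(l, r)) :
  V1^T *m V1 = 1%:M ->
  \tr (H - Hhat) <= \tr H - frob (A *m V1) + frob (A *m V1 - A *m X *m M).
Proof.
move=> V11; rewrite linearB/= -addrA lerD2l.
have trV1 : \tr (V1 *m V1^T) = r%:R by rewrite mxtrace_mulC V11 mxtrace1.
have := trunc_ky_fan (projector_range V11); rewrite trV1 lexx => /(_ isT).
have -> : \tr (V1 *m V1^T *m (A^T *m P *m A)) = frob (P *m (A *m V1)).
  by rewrite frob_projector// -mulmxA mxtrace_mulC trmx_mul !mulmxA.
have := frob_projector_split (A *m V1) P_proj.
have e : (1%:M - P) *m (A *m V1) = (1%:M - P) *m (A *m V1 - A *m X *m M).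
  rewrite mulmxBr [X in _ = _ - X]mulmxA [(_ - _) *m (A *m X)]mulmxBl.
  by rewrite P_sketch mul1mx subrr mul0mx subr0.
have := frob_projector_le (A *m V1 - A *m X *m M) (projector_compl P_proj).
rewrite -e; lra.
Qed.

Lemma residual_ge0 (x : 'cV[R]_n) : 0 <= (x^T *m (H - Hhat) *m x) 0 0.
Proof.
have -> : x^T *m (H - Hhat) *m x = (residual_root *m x)^T *m (residual_root *m x).
  by rewrite residual_gram trmx_mul !mulmxA.
by rewrite frob_cV mxE frob_ge0.
Qed.

(* Projecting on the span of [V] and [x] captures [Hhat] entirely and leaves
   at least the tail of the spectrum of [H] in the complement. *)
Lemma residual_le (c : R) (x : 'cV[R]_n) :
  (forall Pi : 'M[R]_n, projector Pi -> \tr Pi <= r.+1%:R -> \tr (Pi *m H) <= c) ->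
  (x^T *m (H - Hhat) *m x) 0 0 <= (\tr (H - Hhat) - (\tr H - c)) * frob x.
Proof.
move=> hc; have [V1 _] := orth.
have [Pi [pPi trPi PiV Pix]] : exists Pi : 'M[R]_n,
    [/\ projector Pi, \tr Pi <= r.+1%:R, Pi *m V = V & Pi *m x = x].
  have pV := projector_range V1; have [VT V2] := pV.
  have trV : \tr (V *m V^T) = r%:R by rewrite mxtrace_mulC V1 mxtrace1.
  have VVV : V *m V^T *m V = V by rewrite -mulmxA V1 mulmx1.
  (* The component of [x] orthogonal to the range of [V]; its line is added to [V V^T] unless it is
     0. *)
  pose u := x - V *m V^T *m x.
  have xE : x = V *m V^T *m x + u by rewrite addrC subrK.
  have Vu : V^T *m u = 0 by rewrite mulmxBr !mulmxA V1 mul1mx subrr.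
  have uV : u^T *m V = 0 by rewrite -[V]trmxK -trmx_mul Vu trmx0.
  have [u0|u0] := eqVneq u 0.
    exists (V *m V^T); split=> //; first by rewrite trV ler_nat.
    by rewrite [in RHS]xE u0 addr0.
  have pu := line_projector u0; have [uT u2] := pu.
  set L := _ *: _ in pu uT u2.
  have fu : frob u != 0 by apply: contra u0 => /eqP/frob_eq0/eqP.
  have VL : V *m V^T *m L = 0.
    by rewrite -scalemxAr mulmxA -(mulmxA V) Vu mulmx0 mul0mx scaler0.
  have LV : L *m V = 0 by rewrite -scalemxAl -mulmxA uV mulmx0 scaler0.
  have Lu : L *m u = u.
    by rewrite -scalemxAl -mulmxA frob_cV mul_mx_scalar scalerA mulVf// scale1r.
  exists (V *m V^T + L); split.
  - split; first by rewrite linearD/= VT uT.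
    by rewrite mulmxDl !mulmxDr [X in X + _ + _]V2 u2 VL (mulmxA L) LV mul0mx addr0 add0r.
  - rewrite mxtraceD trV mxtraceZ mxtrace_mulC -[\tr (u^T *m u)]/(frob u).
    by rewrite mulVf// natr1.
  - by rewrite mulmxDl VVV LV addr0.
  - rewrite [in LHS]xE mulmxDr !mulmxDl Lu -(mulmxA V V^T u) Vu mulmx0 add0r.
    rewrite !(mulmxA _ (V *m V^T) x) [X in X *m x + _]V2.
    by rewrite (mulmxA L V V^T) LV !mul0mx addr0 -xE.
set C := residual_root.
have -> : x^T *m (H - Hhat) *m x = (C *m x)^T *m (C *m x).
  by rewrite residual_gram trmx_mul !mulmxA.
rewrite frob_cV mxE mulr1n -{1}Pix mulmxA.
apply: le_trans (frob_mul_cV_le _ _) _; apply: ler_wpM2r; first exact: frob_ge0.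
(* [|C Pi|^2] is the trace of [Pi (H - Hhat)], and [Pi] fixes [V], so [Pi *m Hhat = Hhat]. *)
have -> : frob (C *m Pi) = \tr (Pi *m H) - \tr Hhat.
  have [PT P2] := pPi.
  have -> : frob (C *m Pi) = \tr (Pi *m (C^T *m C) *m Pi).
    by rewrite /frob trmx_mul PT !mulmxA.
  rewrite -residual_gram mxtrace_mulC (mulmxA Pi Pi) P2.
  by rewrite mulmxBr linearB/= /trunc_approx !mulmxA PiV.
by rewrite linearB/=; have := hc _ pPi trPi; lra.
Qed.

End truncation.

(** At machine epsilon 0 the shift [nu] vanishes, [C] is already symmetric and the maximum with 0
    has no effect; [V'] and [s'] are the part of the thin SVD dropped by the truncation. *)
Lemma nystrom_output_exact (R : realType) m n l r (A : 'M[R]_(m, n))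
    (X : 'M[R]_(n, l)) (V : 'M[R]_(n, r)) (Lam : 'M[R]_r) :
  nystrom_output 0 (A^T *m A) X V Lam ->
  exists (P : 'M[R]_m) (q : nat) (V' : 'M[R]_(n, q)) (s : 'rV[R]_r) (s' : 'rV[R]_q),
  [/\ projector P, P *m (A *m X) = A *m X,
      (row_mx V V')^T *m row_mx V V' = 1%:M,
      (forall i, 0 <= row_mx s s' 0 i) /\
      (forall i j : 'I_(r + q), (i <= j)%N -> row_mx s s' 0 j <= row_mx s s' 0 i)
    & A^T *m P *m A =
        row_mx V V' *m diag_mx (sqr_row (row_mx s s')) *m (row_mx V V')^T /\
      nystrom_approx V Lam = trunc_approx V s].
Proof.
rewrite /nystrom_output mulr0 mul0r scale0r addr0.
have CE : X^T *m (A^T *m A *m X) = (A *m X)^T *m (A *m X).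
  by rewrite trmx_mul !mulmxA.
have CT : ((A *m X)^T *m (A *m X))^T = (A *m X)^T *m (A *m X).
  by rewrite trmx_mul trmxK.
rewrite CE CT.
move=> [L [Li [U [s [[_ _ LLT] Lpinv [q [U' [s' [V' svdW]]]] LamE]]]]].
have [_ UU VV s_ok WE] := svdW.
have {}LLT : L *m L^T = (A *m X)^T *m (A *m X).
  have double (M : 'M[R]_l) : M + M = 2 *: M by rewrite scaler_nat mulr2n.
  by rewrite LLT double scalerA mulVf ?scale1r// pnatr_eq0.
exists (nys_proj A X Li), q, V', s, s'; split => //.
- exact: nys_proj_projector LLT Lpinv.
- exact: nys_proj_sketch LLT Lpinv.
split; first by rewrite -nys_gram; exact: svd_gram UU WE.
rewrite /nystrom_approx /trunc_approx LamE; congr (_ *m diag_mx _ *m _).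
by apply/rowP => i; rewrite !mxE subr0 max_r ?sqr_ge0.
Qed.

(** * The pointwise bound on the residual *)

Section error_bound.
Context {R : realType} (m n r l : nat) (A : 'M[R]_(m, n)) (sigma : 'rV[R]_m).
Variables (U : 'M[R]_m) (V : 'M[R]_(n, m)).
Hypothesis svdA : is_thin_svd A U sigma V.
Hypothesis rm : (r <= m)%N.
Variable eps : R.
Hypothesis eps_gt0 : 0 < eps.

Definition lead : 'M[R]_(n, r) := colsub (widen_ord rm) V.

Let UU : U^T *m U = 1%:M. Proof. by case: svdA. Qed.
Let VV : V^T *m V = 1%:M. Proof. by case: svdA. Qed.
Let AE : A = U *m diag_mx sigma *m V^T. Proof. by case: svdA. Qed.

Let VleadE : V^T *m lead = colsub (widen_ord rm) 1%:M.
Proof. by rewrite -VV; apply/matrixP => i j; rewrite !mxE; apply: eq_bigr => k _; rewrite !mxE. Qed.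

Lemma lead_orth : lead^T *m lead = 1%:M.
Proof.
have -> : lead^T *m lead = rowsub (widen_ord rm) (V^T *m lead).
  by apply/matrixP => i j; rewrite !mxE; apply: eq_bigr => k _; rewrite !mxE.
by rewrite VleadE; apply/matrixP => i j; rewrite !mxE.
Qed.

Lemma lead_col_orth (a : 'I_m) : (r <= a)%N -> lead^T *m col a V = 0.
Proof.
move=> ra; have -> : lead^T *m col a V = col a (rowsub (widen_ord rm) (V^T *m V)).
  by apply/matrixP => i j; rewrite !mxE; apply: eq_bigr => k _; rewrite !mxE.
rewrite VV; apply/matrixP => i j; rewrite !mxE.
by case: eqP => // /(congr1 val)/= ia; have := ltn_ord i; rewrite ia ltnNge ra.
Qed.

Lemma col_unit (a : 'I_m) : (col a V)^T *m col a V = 1%:M.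
Proof.
have := congr1 (fun M : 'M[R]_m => M a a) VV.
rewrite !mxE eqxx => Vaa; apply/matrixP => i j; rewrite !ord1 !mxE eqxx -Vaa.
by apply: eq_bigr => k _; rewrite !mxE.
Qed.

Lemma frob_svd k (F : 'M[R]_(m, k)) :
  frob (U *m diag_mx sigma *m F) = \sum_(a < m) lam sigma a * \sum_j F a j ^+ 2.
Proof.
have -> : frob (U *m diag_mx sigma *m F) = frob (diag_mx sigma *m F).
  by rewrite /frob -mulmxA trmx_mul mulmxA -(mulmxA _ U^T) UU mulmx1.
rewrite frobE exchange_big; apply: eq_bigr => a _; rewrite mulr_sumr.
apply: eq_bigr => j _; rewrite mul_diag_mx mxE exprMn lamE.
by [].
Qed.

Variable X : 'M[R]_(n, l).
Local Notation Z := (lead^T *m X).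
Local Notation K := (resolvent eps Z).
Local Notation W := (ridge eps Z).
Local Notation S := (ridge_gram eps Z).

(** [lam sigma r] plus a bound for [|A V1 - A X M|^2] with [M = W^T]: the term in [eps] comes from
    the leading singular directions, the sum from the trailing ones. *)
Definition error_bound : R :=
  lam sigma r + eps * (\sum_(i < r) lam sigma i) * \tr K +
  \sum_(a < m | (r <= a)%N)
    lam sigma a * \tr (X^T *m col a V *m ((col a V)^T *m X) *m S).

Lemma frob_lead : frob (A *m lead) = \sum_(i < r) lam sigma i.
Proof.
rewrite AE -mulmxA VleadE frob_svd.
under eq_bigr do rewrite mulr_sumr.
rewrite exchange_big; apply: eq_bigr => j _; rewrite (bigD1 (widen_ord rm j))//=.
rewrite big1 ?addr0 => [|a aj]; first by rewrite !mxE eqxx expr1n mulr1.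
by rewrite !mxE (negbTE aj) expr0n mulr0.
Qed.

(** In the basis of right singular vectors the leading rows of the residual are those of
    [1 - Z W^T = eps K], and the row of index [a >= r] is [- (col a V)^T X W^T]. *)
Lemma frob_residual_le :
  frob (A *m lead - A *m X *m W^T) <=
    eps * (\sum_(i < r) lam sigma i) * \tr K +
    \sum_(a < m | (r <= a)%N)
      lam sigma a * \tr (X^T *m col a V *m ((col a V)^T *m X) *m S).
Proof.
pose F := V^T *m lead - V^T *m X *m W^T.
have -> : A *m lead - A *m X *m W^T = U *m diag_mx sigma *m F.
  by rewrite AE /F mulmxBr !mulmxA.
rewrite frob_svd (bigID (fun a : 'I_m => (r <= a)%N))/= addrC; apply: lerD.
  under eq_bigl do rewrite -ltnNge.
  rewrite (big_ord_narrow rm) -mulrA mulrCA mulr_suml.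
  apply: ler_sum => i _; rewrite ler_wpM2l ?lam_ge0//.
  have FE j : F (widen_ord rm i) j = eps * K i j.
    have ZE k : (V^T *m X) (widen_ord rm i) k = Z i k.
      by rewrite !mxE; apply: eq_bigr => k' _; rewrite !mxE.
    have -> : F (widen_ord rm i) j = (1%:M - Z *m W^T) i j.
      rewrite /F VleadE [LHS]mxE [RHS]mxE; congr (_ + _); first by rewrite !mxE.
      rewrite [LHS]mxE [RHS]mxE; congr (- _); rewrite [LHS]mxE [RHS]mxE.
      by apply: eq_bigr => k _; rewrite ZE.
    rewrite /ridge trmx_mul resolvent_tr mulmxA gram_resolvent//.
    by rewrite opprB addrC subrK mxE.
  under eq_bigr do rewrite FE exprMn.
  (* One factor [eps] is kept, the other is spent on [eps * frob K <= \tr K]. *)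
  rewrite -mulr_sumr expr2 -mulrA ler_pM2l//.
  apply: le_trans (frob_resolvent_le eps_gt0 Z); rewrite ler_pM2l//.
  rewrite -(frob_tr K) frobE [leRHS](bigD1 i)//=; apply: ler_wpDr.
    by apply: sumr_ge0 => j _; apply: sumr_ge0 => k _; exact: sqr_ge0.
  by apply: ler_sum => k _; rewrite mxE.
apply: ler_sum => a ra; rewrite ler_wpM2l ?lam_ge0// le_eqVlt; apply/orP; left.
apply/eqP; set v := col a V.
have -> : \tr (X^T *m v *m (v^T *m X) *m S) = frob (v^T *m X *m W^T)^T.
  rewrite /ridge_gram; move: (ridge eps Z) => w.
  rewrite frob_tr /frob [in RHS]mxtrace_mulC !trmx_mul !trmxK.
  rewrite -[X^T *m v *m _ *m _]mulmxA [LHS]mxtrace_mulC; congr (\tr _).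
  by rewrite !mulmxA.
rewrite frobE big_ord1 /v tr_col -!row_mul; apply: eq_bigr => j _.
have -> : F a j = - (V^T *m X *m W^T) a j.
  rewrite /F VleadE [LHS]mxE -[RHS]add0r; congr (_ + _); last by rewrite [LHS]mxE.
  rewrite !mxE; case: eqP => // aj; move: ra.
  by rewrite aj leqNgt /= ltn_ord.
by rewrite sqrrN; congr (_ ^+ 2); rewrite [RHS]mxE [RHS]mxE.
Qed.

Lemma quad_trace_ge0 (v : 'cV[R]_n) : 0 <= \tr (X^T *m v *m (v^T *m X) *m S).
Proof.
rewrite /ridge_gram; move: (ridge eps Z) => w.
have -> : \tr (X^T *m v *m (v^T *m X) *m (w^T *m w)) = frob (w *m (X^T *m v))^T.
  rewrite frob_tr /frob !trmx_mul !trmxK -[X^T *m v *m _ *m _]mulmxA.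
  by rewrite [LHS]mxtrace_mulC !mulmxA.
exact: frob_ge0.
Qed.

Lemma error_bound_lead : lam sigma r <= error_bound.
Proof.
rewrite /error_bound -addrA lerDl addr_ge0//.
  rewrite !mulr_ge0 ?tr_resolvent_ge0 ?sumr_ge0// => [|i _]; last exact: lam_ge0.
  exact: ltW.
by apply: sumr_ge0 => a _; rewrite mulr_ge0 ?lam_ge0 ?quad_trace_ge0.
Qed.

Lemma nystrom_residual (Vh : 'M[R]_(n, r)) (Lh : 'M[R]_r) (x : 'cV[R]_n) :
  nystrom_output 0 (A^T *m A) X Vh Lh ->
  0 <= (x^T *m (A^T *m A - nystrom_approx Vh Lh) *m x) 0 0 <= error_bound * frob x.
Proof.
move=> /nystrom_output_exact[P [q [V' [s [s' [pP PX orth [s0 sdec] [svdP ->]]]]]]].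
rewrite (residual_ge0 pP svdP)/=.
have [_ _ _ [sigma0 sigma_dec] _] := svdA.
have HE := svd_gram UU AE.
have kf (Pi : 'M[R]_n) : projector Pi -> \tr Pi <= r.+1%:R ->
    \tr (Pi *m (A^T *m A)) <= \sum_(i < r.+1) lam sigma i.
  by move=> pPi trPi; rewrite HE; exact: ky_fan_le.
apply: le_trans (residual_le pP orth svdP x kf) _.
apply: ler_wpM2r; first exact: frob_ge0.
(* [\tr H] cancels, and of the [r.+1] leading eigenvalues all but [lam sigma r] cancel against
   [frob (A *m lead)]. *)
have := trace_residual_le pP PX orth s0 sdec svdP W^T lead_orth.
have := frob_residual_le; rewrite frob_lead /error_bound big_ord_recr/=; lra.
Qed.

End error_bound.

(** * From the quadratic form of the residual to the step and the condition number *)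

Section perturbation.
Context {R : realType}.

Lemma norm2E n (x : 'cV[R]_n) : norm2 x = Num.sqrt (frob x).
Proof. by rewrite /norm2 frobE big_ord1. Qed.

Lemma specnorm_bounds p n (M : 'M[R]_(p, n)) c :
  (forall x : 'cV[R]_n, frob (M *m x) <= c ^+ 2 * frob x) -> 0 <= c ->
  0 <= specnorm M <= c.
Proof.
move=> Mc c0.
have ub : ubound [set norm2 (M *m x) | x in [set x : 'cV[R]_n | norm2 x <= 1]] c.
  move=> _ [x /= x1 <-]; rewrite norm2E.
  apply: le_trans (ler_wsqrtr (Mc x)) _.
  by rewrite sqrtrM ?sqr_ge0// sqrtr_sqr ger0_norm// -norm2E ler_piMr.
have n0 : norm2 (0 : 'cV[R]_n) = 0 by rewrite norm2E /frob mulmx0 mxtrace0 sqrtr0.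
apply/andP; split.
  apply: ub_le_sup; first by exists c.
  exists 0; rewrite /= ?n0//.
  by rewrite mulmx0 norm2E /frob mulmx0 mxtrace0 sqrtr0.
apply: ge_sup => //; exists (norm2 (M *m 0)); exists 0 => //=.
by rewrite n0.
Qed.

Definition qform n (M : 'M[R]_n) (x : 'cV[R]_n) : R := (x^T *m M *m x) 0 0.

Lemma qformD n (M N : 'M[R]_n) x : qform (M + N) x = qform M x + qform N x.
Proof. by rewrite /qform mulmxDr mulmxDl mxE. Qed.

Lemma qformB n (M N : 'M[R]_n) x : qform (M - N) x = qform M x - qform N x.
Proof. by rewrite /qform mulmxBr mulmxBl !mxE. Qed.

Lemma qform1 n (x : 'cV[R]_n) : qform 1%:M x = frob x.
Proof. by rewrite /qform mulmx1 frob_cV mxE. Qed.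

Lemma qform_congr n (S M : 'M[R]_n) x : S^T = S ->
  qform (S *m M *m S) x = qform M (S *m x).
Proof. by move=> ST; rewrite /qform trmx_mul ST !mulmxA. Qed.

Lemma frob_mul_sym n (M : 'M[R]_n) (x : 'cV[R]_n) : M^T = M -> frob (M *m x) = qform (M *m M) x.
Proof. by move=> MT; rewrite -qform1 -qform_congr// mulmx1. Qed.

(** The form is nonnegative at [c *: x - M *m x]; expanding and using
    [qform M (M *m x) <= c * frob (M *m x)] gives [frob (M *m x) <= c * qform M x]. *)
Lemma frob_sym_le n (M : 'M[R]_n) c (x : 'cV[R]_n) : M^T = M -> 0 < c ->
  (forall x : 'cV[R]_n, 0 <= qform M x <= c * frob x) ->
  frob (M *m x) <= c ^+ 2 * frob x.
Proof.
move=> MT c0 hM.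
have /andP[_ up] := hM (M *m x); have /andP[_ a_le] := hM x.
have /andP[ge _] := hM (c *: x - M *m x).
have sq : qform M (c *: x - M *m x) =
    c ^+ 2 * qform M x - 2 * c * frob (M *m x) + qform M (M *m x).
  have e : c *: x - M *m x = (c%:M - M) *m x by rewrite mulmxBl mul_scalar_mx.
  have cT : (c%:M - M)^T = c%:M - M by rewrite linearB/= tr_scalar_mx MT.
  rewrite e -(qform_congr M x cT) -(qform_congr M x MT) frob_mul_sym//.
  have -> : (c%:M - M) *m M *m (c%:M - M) =
     c ^+ 2 *: M - c *: (M *m M) - (c *: (M *m M) - M *m M *m M).
    rewrite mulmxBl mul_scalar_mx mulmxBr mul_mx_scalar mulmxBl -scalemxAl.
    by rewrite scalerBr scalerA -expr2.
  have qZ b (N : 'M[R]_n) : qform (b *: N) x = b * qform N x.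
    by rewrite /qform -scalemxAr -scalemxAl mxE.
  by rewrite !qformB !qZ; ring.
rewrite sq in ge.
have : c * frob (M *m x) <= c * (c * qform M x) by nra.
rewrite ler_pM2l// => /le_trans; apply.
by rewrite expr2 -mulrA ler_pM2l.
Qed.

Lemma frob_addpsd_ge n (E : 'M[R]_n) (x : 'cV[R]_n) : E^T = E -> 0 <= qform E x ->
  frob x <= frob ((1%:M + E) *m x).
Proof.
move=> ET E0; rewrite frob_mul_sym; last by rewrite linearD/= trmx1 ET.
have -> : (1%:M + E) *m (1%:M + E) = 1%:M + E + (E + E *m E).
  by rewrite mulmxDl mul1mx mulmxDr mulmx1.
rewrite !qformD qform1 -frob_mul_sym//; have := frob_ge0 (E *m x); lra.
Qed.

Lemma qform_pos_unit n (M : 'M[R]_n) : (forall x, x != 0 -> 0 < qform M x) ->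
  M \in unitmx.
Proof.
move=> Mpos; rewrite -unitmx_tr -row_free_unit; apply: inj_row_free => u uM.
apply/eqP; apply: contraT => u0.
have : 0 < qform M u^T by apply: Mpos; rewrite -(inj_eq trmx_inj) trmxK trmx0.
have -> : qform M u^T = 0; last by rewrite ltxx.
by rewrite /qform -mulmxA -[M]trmxK -trmx_mul uM trmx0 mulmx0 mxE.
Qed.

Lemma invmx0 n : invmx (0 : 'M[R]_n) = 0.
Proof.
case: (boolP ((0 : 'M[R]_n) \in unitmx)) => [u0|nu]; last exact: invmx_out.
by rewrite -[LHS]mul1mx -(mulmxV u0) !mul0mx.
Qed.

(** The first case is the default value of [xget], which the two comparisons treat separately. *)
Lemma sqrtmx_cases n (M : 'M[R]_n) :
  sqrtmx M = 0 \/ psdmx (sqrtmx M) /\ sqrtmx M *m sqrtmx M = M.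
Proof.
rewrite /sqrtmx; case: xgetP => [S _ [psdS SS]|_]; by [right|left].
Qed.

Lemma sqrtmxP n (M S : 'M[R]_n) : psdmx S -> S *m S = M ->
  psdmx (sqrtmx M) /\ sqrtmx M *m sqrtmx M = M.
Proof.
by move=> psdS SS; rewrite /sqrtmx; case: xgetP => [S' _ //|/(_ S)]; case.
Qed.

Section comparison.
Variables (n : nat) (H Hh : 'M[R]_n) (e : R).
Hypothesis e_gt0 : 0 < e.
Hypothesis HT : H^T = H.
Hypothesis HhT : Hh^T = Hh.
Hypothesis Hh_psd : forall x, 0 <= qform Hh x.
Hypothesis H_Hh : forall x : 'cV[R]_n, 0 <= qform (H - Hh) x <= e * frob x.

Lemma step_error (Gam : 'M[R]_n) (g dx dxh : 'cV[R]_n) :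
  spdmx Gam -> g != 0 ->
  gn_hessian Gam H *m dx = - g -> gn_hessian Gam Hh *m dxh = - g ->
  0 <= wnorm (invmx Gam) (dx - dxh) / wnorm (invmx Gam) dx <= e.
Proof.
move=> [GT Gpos] g0 hx hxh.
have uG : Gam \in unitmx by exact: qform_pos_unit.
(* With the default root 0 the equation for [dx] reads [0 = - g], against [g != 0]. *)
have [S0|[[ST Spsd] SS]] := sqrtmx_cases Gam.
  by move: hx g0; rewrite /gn_hessian S0 invmx0 mulmx0 mul0mx => /esym/eqP;
    rewrite oppr_eq0 => ->.
rewrite /gn_hessian in hx hxh; set S := sqrtmx Gam in ST Spsd SS hx hxh.
have uS : S \in unitmx by move: uG; rewrite -SS unitmx_mul andbb.
set Ti := invmx S in hx hxh.
have TT : Ti^T = Ti by rewrite /Ti trmx_inv ST.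
have Tpsd : psdmx Ti.
  split=> // x; rewrite -[_ 0 0]/(qform Ti x).
  have -> : qform Ti x = qform S (Ti *m x).
    by rewrite -qform_congr// /Ti mulVmx// mul1mx.
  exact: Spsd.
have T2 : Ti *m Ti = invmx Gam.
  have h : Ti *m Ti *m Gam = 1%:M.
    by rewrite -SS mulmxA -(mulmxA Ti Ti S) mulVmx// mulmx1 mulVmx.
  by rewrite -[LHS](mulmxK uG) h mul1mx.
(* Both [sqrtmx (invmx Gam)] and [Ti] are symmetric with square [invmx Gam], and the norm depends on
   this square alone. *)
have wE (x : 'cV[R]_n) : wnorm (invmx Gam) x = Num.sqrt (frob (Ti *m x)).
  have [[S'T _] S'2] := sqrtmxP Tpsd T2.
  by rewrite /wnorm norm2E !frob_mul_sym// S'2 T2.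
rewrite !wE divr_ge0 ?sqrtr_ge0//=.
set y := Ti *m dx; have zE : Ti *m (dx - dxh) = y - Ti *m dxh by rewrite mulmxBr.
have lin (M : 'M[R]_n) (x : 'cV[R]_n) : Ti *m M *m Ti *m x = - g -> M *m (Ti *m x) = - (S *m g).
  by move=> h; rewrite -mulmxN -h !mulmxA /Ti mulmxV// mul1mx.
have z_eq : (1%:M + Hh) *m (Ti *m (dx - dxh)) = - ((H - Hh) *m y).
  rewrite zE mulmxBr (lin _ _ hxh) -(lin _ _ hx) -/y -mulmxBl -mulNmx; congr (_ *m _).
  by rewrite opprD addrACA subrr add0r opprB.
have ET : (H - Hh)^T = H - Hh by rewrite linearB/= HT HhT.
have frN (x : 'cV[R]_n) : frob (- x) = frob x.
  by rewrite !frobE; do 2 (apply: eq_bigr => ? _); rewrite mxE sqrrN.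
have zy : frob (Ti *m (dx - dxh)) <= e ^+ 2 * frob y.
  apply: le_trans (frob_addpsd_ge HhT (Hh_psd _)) _.
  by rewrite z_eq frN; exact: frob_sym_le.
have := ler_wsqrtr zy; rewrite sqrtrM ?sqr_ge0// sqrtr_sqr (ger0_norm (ltW e_gt0)) => zy'.
(* For a vanishing denominator the quotient is 0 by the convention [0^-1 = 0]. *)
have [y0|y0] := eqVneq (Num.sqrt (frob y)) 0; first by rewrite y0 invr0 mulr0 ltW.
by rewrite ler_pdivrMr// lt_neqAle eq_sym y0 sqrtr_ge0.
Qed.

(** For [Ti = (I + Hh)^(-1/2)] the operator is [I + Ti (H - Hh) Ti]. It lies between [I] and
    [(1 + e) I] because [Ti] is a contraction, so its inverse has norm at most 1. *)
Lemma prec_cond :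
  0 <= cond2 (prec_operator H Hh) <= 1 + e.
Proof.
rewrite /cond2.
have [S0|[[ST Spsd] SS]] := sqrtmx_cases (1%:M + Hh).
  (* With the default root 0 the operator is 0, and so is the product of the two norms. *)
  have fr0 (x : 'cV[R]_n) : frob ((0 : 'M[R]_n) *m x) <= 0 ^+ 2 * frob x.
    by rewrite mul0mx /frob mulmx0 mxtrace0 expr0n mul0r.
  have /andP[s0 s1] := specnorm_bounds fr0 (lexx 0).
  rewrite /prec_operator S0 !invmx0 mulmx0 invmx0.
  by rewrite mulr_ge0//= (le_trans (mulr_le0_ge0 s1 s0))// addr_ge0// ltW.
rewrite /prec_operator; set S := sqrtmx _ in ST Spsd SS *.
have uI : 1%:M + Hh \in unitmx.
  apply: qform_pos_unit => x x0; rewrite qformD qform1 ltr_wpDr//.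
  by rewrite lt_neqAle frob_ge0 andbT eq_sym; apply: contra x0 => /eqP/frob_eq0/eqP.
have uS : S \in unitmx by move: uI; rewrite -SS unitmx_mul andbb.
set Ti := invmx S; have TT : Ti^T = Ti by rewrite /Ti trmx_inv ST.
set M := Ti *m _ *m Ti.
have MT : M^T = M by rewrite /M !trmx_mul TT linearD/= trmx1 HT mulmxA.
have IHh (x : 'cV[R]_n) : qform (1%:M + Hh) (Ti *m x) = frob x.
  by rewrite -SS -{1}[S]mulmx1 qform_congr// qform1 mulmxA mulmxV// mul1mx.
have ME (x : 'cV[R]_n) : qform M x = frob x + qform (H - Hh) (Ti *m x).
  rewrite qform_congr//.
  have -> : 1%:M + H = 1%:M + Hh + (H - Hh) by rewrite -addrA [Hh + _]addrC subrK.
  by rewrite [LHS]qformD IHh.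
have Tle (x : 'cV[R]_n) : frob (Ti *m x) <= frob x.
  by rewrite -[leRHS]IHh qformD qform1 lerDl.
have Mb (x : 'cV[R]_n) : 0 <= qform M x <= (1 + e) * frob x.
  have /andP[h1 h2] := H_Hh (Ti *m x); rewrite ME addr_ge0 ?frob_ge0//=.
  rewrite mulrDl mul1r lerD2l (le_trans h2)// ler_pM2l//.
have e1 : 0 < 1 + e by rewrite addr_gt0.
have /andP[a0 a1] := specnorm_bounds (fun x => frob_sym_le x MT e1 Mb) (ltW e1).
have M1 (x : 'cV[R]_n) : frob x <= frob (M *m x).
  have -> : M = 1%:M + (M - 1%:M) by rewrite addrC subrK.
  apply: frob_addpsd_ge; first by rewrite linearB/= MT trmx1.
  by rewrite qformB ME qform1 addrAC subrr add0r; case/andP: (H_Hh (Ti *m x)).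
have uM : M \in unitmx.
  apply: qform_pos_unit => x x0; rewrite ME ltr_wpDr//.
    by case/andP: (H_Hh (Ti *m x)).
  by rewrite lt_neqAle frob_ge0 andbT eq_sym; apply: contra x0 => /eqP/frob_eq0/eqP.
have inv_le (x : 'cV[R]_n) : frob (invmx M *m x) <= 1 ^+ 2 * frob x.
  by rewrite expr1n mul1r (le_trans (M1 _))// mulmxA mulmxV// mul1mx.
have /andP[b0 b1] := specnorm_bounds inv_le ler01.
by rewrite mulr_ge0//= -[leRHS]mulr1 ler_pM.
Qed.

End comparison.
End perturbation.

(** * The expected error bound and the limit in the ridge parameter *)

(** The integral of a nonnegative function is a supremum over simple functions below it, hence
    monotone for arbitrary functions. This covers errors built from an arbitrary selection of
    algorithm outputs. *)
Lemma ge0_le_integral_nonmeasurable d (T : measurableType d) (R : realType)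
    (mu : {measure set T -> \bar R}) (f g : T -> \bar R) :
  (forall x, 0 <= f x)%E -> (forall x, f x <= g x)%E ->
  (\int[mu]_x f x <= \int[mu]_x g x)%E.
Proof.
move=> f0 fg; have g0 x : (0 <= g x)%E by exact: le_trans (f0 x) (fg x).
rewrite !ge0_integralTE//; apply: le_ereal_sup => _ [h hf <-].
by exists h => // x; exact: le_trans (hf x) (fg x).
Qed.

Section expected_error_bound.
Context d (T : measurableType d) (R : realType) (P : probability T R).
Context (m n r p : nat) (A : 'M[R]_(m, n)) (sigma : 'rV[R]_m).
Context (Omega : 'I_n * 'I_(r + p) -> {RV P >-> R}).
Hypothesis gaussOmega : standard_gaussian Omega.
Hypothesis p_ge2 : (2 <= p)%N.
Variables (U : 'M[R]_m) (V : 'M[R]_(n, m)).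
Hypothesis svdA : is_thin_svd A U sigma V.
Hypothesis mn : (m <= n)%N.
Hypothesis rm : (r <= m)%N.
Local Notation Om w := (sample_mx Omega w).
Local Notation bound eps w := (error_bound sigma V rm eps (Om w)).

Let kappa : R := r%:R / (p%:R - 1).
Let top : R := \sum_(i < r) lam sigma i.

Lemma tail_lam : \sum_(a < m | (r <= a)%N) lam sigma a = \sum_(r <= j < n) lam sigma j.
Proof.
rewrite (big_cat_nat rm mn)/= [X in _ = _ + X]big_nat_cond [X in _ = _ + X]big1 ?addr0; last first.
  by move=> j /andP[/andP[mj _] _]; exact: lam_default.
by rewrite big_geq_mkord.
Qed.

Lemma expected_error_bound (c eps : R) : 0 <= c -> 0 < eps ->
  (\int[P]_w (c + bound eps w)%:E <= (c + Psi n sigma r p + eps * (top * kappa))%:E)%E.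
Proof.
move=> c0 eps0.
have pE : (r + p)%:R - r%:R - 1 = p%:R - 1 :> R by rewrite natrD; ring.
have rl : (r.+1 < r + p)%N by rewrite -addn1 ltn_add2l.
have V1 := lead_orth svdA rm.
have EK := expected_tr_resolvent gaussOmega eps0 V1 rl.
rewrite pE -/kappa in EK.
have iK := integrable_tr_resolvent Omega (lead V rm) eps0.
pose q (a : 'I_m) w := \tr ((Om w)^T *m col a V *m ((col a V)^T *m Om w) *m
  ridge_gram eps ((lead V rm)^T *m Om w)).
have iq (a : 'I_m) : (r <= a)%N -> P.-integrable setT (fun w => (q a w)%:E) /\
    (\int[P]_w (q a w)%:E <= kappa%:E)%E.
  move=> ra.
  have [i1 i2] := integrable_quad gaussOmega eps0 (col_unit svdA a) (lead_col_orth svdA rm ra).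
  by split=> //; exact: le_trans i2 EK.
have isum : P.-integrable setT
    (fun w => \sum_(a < m | (r <= a)%N) ((lam sigma a)%:E * (q a w)%:E))%E.
  apply: integrable_sum => // a ra; apply: integrableZl => //.
  by case: (iq a ra).
have iKZ : P.-integrable setT (fun w =>
    ((eps * top)%:E * (\tr (resolvent eps ((lead V rm)^T *m Om w)))%:E)%E).
  exact: integrableZl.
have ic : P.-integrable setT (fun=> (c + lam sigma r)%:E).
  exact: finite_measure_integrable_cst.
have -> : (fun w => (c + bound eps w)%:E) = (fun w => (c + lam sigma r)%:E +
   ((eps * top)%:E * (\tr (resolvent eps ((lead V rm)^T *m Om w)))%:E +
   \sum_(a < m | (r <= a)%N) ((lam sigma a)%:E * (q a w)%:E)))%E.
  apply/funext => w; rewrite /error_bound.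
  under [in RHS]eq_bigr do rewrite -EFinM.
  by rewrite sumEFin -!EFinM -!EFinD !addrA.
rewrite integralD//; last exact: integrableD.
rewrite integralD// integralZl//.
have -> : (\int[P]_w \sum_(a < m | (r <= a)%N) ((lam sigma a)%:E * (q a w)%:E) =
    \sum_(a < m | (r <= a)%N) (lam sigma a)%:E * \int[P]_w (q a w)%:E)%E.
  under eq_integral do rewrite big_mkcond.
  rewrite big_mkcond integral_sum//=; last first.
    move=> a; have [ra|_] := leqP r a; last exact: integrable0.
    by apply: integrableZl => //; case: (iq a ra).
  apply: eq_bigr => a _; have [ra|_] := leqP r a; last exact: integral0.
  by rewrite integralZl//; case: (iq a ra).
have -> : (c + Psi n sigma r p + eps * (top * kappa))%:E =
  ((c + lam sigma r)%:E + ((eps * top)%:E * kappa%:E +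
   \sum_(a < m | (r <= a)%N) (lam sigma a)%:E * kappa%:E))%E.
  under eq_bigr do rewrite -EFinM.
  rewrite sumEFin -EFinM -!EFinD /Psi -tail_lam -mulr_suml -/kappa; congr _%:E; ring.
apply: leeD; last apply: leeD.
- by rewrite integral_cst// [X in (_ * X)%E](@probability_setT _ _ _ P) mule1.
- apply: lee_wpmul2l => //; rewrite lee_fin; apply: mulr_ge0; first exact: ltW.
  by rewrite /top sumr_ge0// => i _; exact: lam_ge0.
- apply: lee_sum => a ra; apply: lee_wpmul2l; first by rewrite lee_fin lam_ge0.
  by case: (iq a ra).
Qed.

(** [c] is 0 for the step error and 1 for the condition number. As [Y] does not involve [eps], the
    excess [eps * (top * kappa)] can be made arbitrarily small. *)
Lemma expectation_le_Psi (c : R) (Y : T -> R) : 0 <= c ->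
  (forall w, 0 <= Y w) ->
  (forall eps w, 0 < eps -> Y w <= c + bound eps w) ->
  ('E_P[Y] <= (c + Psi n sigma r p)%:E)%E.
Proof.
move=> c0 Y0 Yb; rewrite unlock.
have kappa0 : 0 <= kappa.
  by rewrite divr_ge0// subr_ge0 ler1n (leq_trans _ p_ge2).
have top0 : 0 <= top by apply: sumr_ge0 => i _; exact: lam_ge0.
apply/lee_addgt0Pr => delta delta0; rewrite -EFinD.
(* The added 1 keeps the denominator positive when [top * kappa] is 0, as for [r = 0]. *)
pose eps := delta / (top * kappa + 1).
have tk0 : 0 < top * kappa + 1 by rewrite ltr_wpDl// mulr_ge0.
have eps0 : 0 < eps by rewrite divr_gt0.
apply: le_trans (_ : _ <= (c + Psi n sigma r p + eps * (top * kappa))%:E)%E _.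
  apply: le_trans (expected_error_bound c0 eps0).
  by apply: ge0_le_integral_nonmeasurable => w; rewrite lee_fin ?Yb.
rewrite lee_fin lerD2l /eps mulrAC ler_pdivrMr// ler_pM2l//.
by rewrite lerDl.
Qed.

End expected_error_bound.

Lemma nystrom_approx_psd (R : realType) m n l r (A : 'M[R]_(m, n))
    (X : 'M[R]_(n, l)) (V : 'M[R]_(n, r)) (Lam : 'M[R]_r) :
  nystrom_output 0 (A^T *m A) X V Lam ->
  (nystrom_approx V Lam)^T = nystrom_approx V Lam /\
  forall x, 0 <= qform (nystrom_approx V Lam) x.
Proof.
move=> /nystrom_output_exact[_ [_ [_ [s [_ [_ _ _ _ [_ ->]]]]]]].
have -> : trunc_approx V s = (diag_mx s *m V^T)^T *m (diag_mx s *m V^T).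
  by rewrite /trunc_approx -diag_sqr_row trmx_mul trmxK tr_diag_mx !mulmxA.
split=> [|x]; first by rewrite trmx_mul trmxK.
by rewrite /qform mulmxA -mulmxA -trmx_mul frob_cV mxE frob_ge0.
Qed.

Theorem theorem2 (d : measure_display) (T : measurableType d) (R : realType)
    (P : probability T R) (m n r p : nat)
    (A : 'M[R]_(m, n)) (sigma : 'rV[R]_m) (Gam : 'M[R]_n)
    (Omega : 'I_n * 'I_(r + p) -> {RV P >-> R})
    (Vhat : T -> 'M[R]_(n, r)) (Lhat : T -> 'M[R]_r)
    (hmn : (m <= n)%N)
    (hsigma : is_singular_values A sigma)
    (hGam : spdmx Gam)
    (hrm : (r <= m)%N)
    (hlam : lam sigma r != 0)
    (hp : (2 <= p)%N)
    (hOmega : standard_gaussian Omega)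
    (hNys : forall w,
      nystrom_output 0 (A^T *m A) (sample_mx Omega w) (Vhat w) (Lhat w)) :
  let H := A^T *m A in
  let Hhat := fun w => nystrom_approx (Vhat w) (Lhat w) in
  [/\ Psi n sigma r p =
        (1 + r%:R / (p%:R - 1) * intdim n sigma r) * lam sigma r,
      (forall (g dx : 'cV[R]_n) (dxhat : T -> 'cV[R]_n),
         g != 0 ->
         gn_hessian Gam H *m dx = - g ->
         (forall w, gn_hessian Gam (Hhat w) *m dxhat w = - g) ->
         ('E_P[fun w =>
               (wnorm (invmx Gam) (dx - dxhat w) / wnorm (invmx Gam) dx)%R]
            <= (Psi n sigma r p)%:E)%E)
    & ('E_P[fun w => cond2 (prec_operator H (Hhat w))]
         <= (1 + Psi n sigma r p)%:E)%E].
Proof.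
move=> H Hhat.
have [U [V svdA]] := hsigma.
have rm : (r < m)%N.
  by rewrite ltnNge; apply: contra hlam => mr; rewrite lam_default.
have lam0 : 0 < lam sigma r by rewrite lt_neqAle eq_sym hlam lam_ge0.
pose e eps w := error_bound sigma V hrm eps (sample_mx Omega w).
have e0 eps w : 0 < eps -> 0 < e eps w.
  by move=> eps0; rewrite (lt_le_trans lam0)// error_bound_lead.
have HT : H^T = H by rewrite /H trmx_mul trmxK.
have psd w : (Hhat w)^T = Hhat w /\ forall x, 0 <= qform (Hhat w) x.
  exact: nystrom_approx_psd (hNys w).
have res eps w : 0 < eps ->
    forall x : 'cV[R]_n, 0 <= qform (H - Hhat w) x <= e eps w * frob x.
  move=> eps0 x.
  exact: (nystrom_residual svdA hrm eps0 x (hNys w)).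
split.
- by rewrite /Psi /intdim mulrDl mul1r -[_ * lam sigma r]mulrA divfK.
- move=> g dx dxhat g0 hdx hdxhat.
  have main eps w (eps0 : 0 < eps) := step_error (e0 eps w eps0) HT (psd w).1 (psd w).2
    (res eps w eps0) hGam g0 hdx (hdxhat w).
  rewrite -[Psi _ _ _ _]add0r.
  apply: (expectation_le_Psi hOmega hp svdA hmn (rm := hrm)) => // [w|eps w eps0].
    (* Nonnegativity does not involve [eps]; the value 1 is arbitrary. *)
    by case/andP: (main 1 w ltr01).
  by rewrite add0r; case/andP: (main eps w eps0).
- have main eps w (eps0 : 0 < eps) := prec_cond (e0 eps w eps0) HT (psd w).2
    (res eps w eps0).
  apply: (expectation_le_Psi hOmega hp svdA hmn (rm := hrm)) => // [w|eps w eps0].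
    by case/andP: (main 1 w ltr01).
  by case/andP: (main eps w eps0).
Qed.
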